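(* The octahedral sphere is the only exceptional balanced triangulation of the $2$-sphere.
   Context: A triangulation of a closed surface $F^2$ is a simple graph embedded on $F^2$ such that every face is bounded by a $3$-cycle and any two faces share at most one edge; it is balanced if its graph is $3$-colorable; a face on $a,b,c$ is written $abc$. The octahedral sphere is the boundary of the cross $3$-polytope (6 vertices, all of degree $4$). Operations must produce again a triangulation (no multiple edges), and every triangle named is a face. P-splitting: if a vertex $v$ lies in faces $vwx, vxy, vyz$ with $w,x,y,z$ distinct and $wz$ is not an edge, introduce a new vertex $u$ (colored as $v$), delete these three faces and the edges $vx, vy$, and add the faces $vwz, uwz, uwx, uxy, uyz$. P-contraction: the inverse, i.e. if $u$ has degree $4$ lying in faces $uwx, uxy, uyz, uzw$, and $vwz$ is a face with $v\neq u$ such that $vx, vy$ are not edges, delete $u$ and edge $wz$ and replace the faces $uwx,uxy,uyz,uzw,vwz$ by $vwx, vxy, vyz$. For a closed surface $F^2$, fix an integer $M$ such that any two balanced triangulations of $F^2$ with at least $M$ vertices can be transformed into each other by a sequence of P-splittings and P-contractions (such an $M$ exists). A balanced triangulation $G$ of $F^2$ is exceptional if $G$ cannot be connected by a sequence of P-splittings and P-contractions to any balanced triangulation $G'$ of $F^2$ with $|V(G')|\ge M$; this does not depend on the choice of $M$. *)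

(* Defs.v *)
From Stdlib Require Import Relation_Operators.
From HB Require Import structures.
From mathcomp Require Import all_boot all_order all_algebra.

Set Implicit Arguments.
Unset Strict Implicit.
Unset Printing Implicit Defensive.

(* An embedded simple graph all of whose faces are bounded by 3-cycles, no two
   faces sharing more than one edge, is determined by the vertex sets of its
   faces: a face is the set of its three vertices, distinct faces have distinct
   vertex sets, and every edge lies on a face. *)
Record tricomplex := Tricomplex {
  nv : nat;
  faces : {set {set 'I_nv}} }.

Section Combinatorics.
Variable G : tricomplex.
Implicit Types x y v : 'I_(nv G).

Definition adj : rel 'I_(nv G) :=
  [rel x y | (x != y) && [exists f in faces G, (x \in f) && (y \in f)]].

Definition degree v : nat := #|[set x | adj v x]|.

Definition link_rel v : rel 'I_(nv G) :=
  [rel x y | [set v; x; y] \in faces G].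

(* Two faces on every edge make each vertex link a disjoint union of cycles;
   link connectedness makes it a single cycle, so that G triangulates a closed
   surface, which is connected when the graph is. *)
Definition surface_triangulation : Prop :=
  [/\ (0 < nv G)%N /\ (forall v, exists2 f, f \in faces G & v \in f),
      forall f, f \in faces G -> #|f| = 3,
      forall x y, adj x y ->
        #|[set f in faces G | (x \in f) && (y \in f)]| = 2,
      forall v x y, adj v x -> adj v y -> connect (link_rel v) x y
    & forall x y, connect adj x y].

Definition balanced : Prop :=
  exists c : 'I_(nv G) -> 'I_3, forall x y, adj x y -> c x <> c y.

End Combinatorics.

Definition relabel (m n : nat) (f : 'I_m -> 'I_n) (T : {set {set 'I_m}}) :
  {set {set 'I_n}} := [set f @: s | s : {set 'I_m} in T].

Definition isomorphic (G H : tricomplex) : Prop :=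
  exists2 f : 'I_(nv G) -> 'I_(nv H),
    bijective f & relabel f (faces G) = faces H.

Definition embeds_off (m n : nat) (f : 'I_m -> 'I_n) (u : 'I_n) : Prop :=
  injective f /\ forall j, (j \in codom f) = (j != u).

(* The vertices of H are those of G, carried over by f, and the new vertex u. *)
Definition P_splitting (G H : tricomplex) : Prop :=
  exists (f : 'I_(nv G) -> 'I_(nv H)) (u : 'I_(nv H)) (v w x y z : 'I_(nv G)),
    [/\ embeds_off f u,
        uniq [:: w; x; y; z],
        [/\ [set v; w; x] \in faces G, [set v; x; y] \in faces G
          & [set v; y; z] \in faces G],
        ~~ adj w z
      & faces H =
          relabel f (faces G :\: [set [set v; w; x]; [set v; x; y]; [set v; y; z]])
          :|: [set [set f v; f w; f z]; [set u; f w; f z]; [set u; f w; f x];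
                   [set u; f x; f y]; [set u; f y; f z]] ].

(* The vertices of H are carried by f onto those of G other than u. *)
Definition P_contraction (G H : tricomplex) : Prop :=
  exists (f : 'I_(nv H) -> 'I_(nv G)) (u v w x y z : 'I_(nv G)),
    [/\ embeds_off f u,
        uniq [:: w; x; y; z] /\ degree u = 4,
        [/\ [set u; w; x] \in faces G, [set u; x; y] \in faces G,
            [set u; y; z] \in faces G & [set u; z; w] \in faces G],
        [/\ [set v; w; z] \in faces G, v != u, ~~ adj v x & ~~ adj v y]
      & relabel f (faces H) =
          (faces G :\: [set [set u; w; x]; [set u; x; y]; [set u; y; z];
                            [set u; z; w]; [set v; w; z]])
          :|: [set [set v; w; x]; [set v; x; y]; [set v; y; z]] ].

(* Triangulations are considered up to renaming of their vertices. *)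
Definition P_move (G H : tricomplex) : Prop :=
  isomorphic G H \/
  (surface_triangulation H /\ (P_splitting G H \/ P_contraction G H)).

Definition P_connected : tricomplex -> tricomplex -> Prop :=
  clos_refl_trans tricomplex P_move.

(* The antipodal pairs of vertices of the cross-polytope are {2k, 2k+1}; a
   facet has exactly one vertex in each pair. *)
Definition octahedral_sphere : tricomplex :=
  @Tricomplex 6 [set f : {set 'I_6} |
    [forall k : 'I_3, #|[set i in f | i %/ 2 == k]| == 1]].

From mathcomp Require Import all_classical all_reals topology normedtype.
Import Order.TTheory GRing.Theory Num.Theory.
Import numFieldNormedType.Exports.
Local Open Scope ring_scope.
Local Open Scope classical_set_scope.

Definition homeomorphic (X Y : topologicalType) (A : set X) (B : set Y) : Prop :=
  exists (f : X -> Y) (g : Y -> X),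
    [/\ {within A, continuous f} /\ {within B, continuous g},
        forall a, A a -> B (f a), forall b, B b -> A (g b),
        forall a, A a -> g (f a) = a & forall b, B b -> f (g b) = b].

(* Geometric realization in barycentric coordinates. *)
Definition realization (R : realType) (G : tricomplex) : set 'rV[R]_(nv G) :=
  [set t : 'rV[R]_(nv G) | [/\ forall i, 0 <= t 0 i, \sum_i t 0 i = 1
             & exists2 s : {set 'I_(nv G)}, s \in faces G & forall i, i \notin s -> t 0 i = 0]].

Arguments realization : clear implicits.

Definition sphere2 (R : realType) : set 'rV[R]_3 :=
  [set p : 'rV[R]_3 | \sum_i p 0 i ^+ 2 = 1].

Arguments sphere2 : clear implicits.

Section Surface.
Variables (R : realType) (X : topologicalType) (F : set X).

(* F is given as a subspace of X. When F is a closed surface and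
   the faces are 3-sets covering the vertices, the realization clause already
   forces the edge, link and connectedness clauses of surface_triangulation. *)
Definition balanced_triangulation_of (G : tricomplex) : Prop :=
  [/\ surface_triangulation G, balanced G & homeomorphic (realization R G) F].

Definition flip_threshold (M : nat) : Prop :=
  forall G H : tricomplex,
    balanced_triangulation_of G -> balanced_triangulation_of H ->
    (M <= nv G)%N -> (M <= nv H)%N -> P_connected G H.

Definition exceptional (M : nat) (G : tricomplex) : Prop :=
  balanced_triangulation_of G /\
  ~ exists H : tricomplex,
      [/\ balanced_triangulation_of H, (M <= nv H)%N & P_connected G H].

End Surface.

(* Main.v *)
Require Import Defs.
From Stdlib Require Import Relation_Operators.
From mathcomp Require Import all_boot all_order all_algebra.

Set Implicit Arguments.
Unset Strict Implicit.
Unset Printing Implicit Defensive.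

(* The octahedron admits no P-move at all, and a single P-splitting already
   enables infinitely many: after splitting [v] along [w, x, y, z], the edge [vx]
   is gone, so that [w] can be split along [v, z, u, x], and so on. It remains to
   find a first splitting of a balanced triangulated sphere other than the
   octahedron. If there is none, all chords [l0 l3] of the link of a vertex [v]
   are edges; in a link of length at least 6 the closed curves [v l0 l3] and
   [v l1 l4] then cross exactly once, which is impossible because the first one
   bounds modulo 2 (every double cover of the sphere is trivial). Hence every
   link is a 4-cycle, and the triangulation is the octahedron.
   A P-splitting preserves the homeomorphism type because it is an edge
   subdivision followed by two edge flips, and a flip is an edge subdivision
   followed by the inverse of another one. If [M <= 6], the threshold hypothesis
   is refuted by the octahedron and its double edge subdivision. *)

(** The 3-coloring enters through the links: along the link of [v] the two colors other than that of
    [v] alternate, so vertices three apart are distinct and no link is a 5-cycle. That a closed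
    curve bounds modulo 2 is needed in the form of a 2-coloring of the faces that changes exactly
    across the curve. Around a single vertex such a coloring always exists; the discrepancies
    between the colorings at adjacent vertices form a 1-cocycle modulo 2, and the sphere enters only
    through the fact that this cocycle is a coboundary. The cocycle glues a double cover, which is
    trivialized over squares and then glued along connected sets. Being a sphere is defined by a
    homeomorphism. To keep topology apart, the combinatorial part carries an arbitrary property [P]
    that is invariant under renaming and, in both directions, under edge subdivision. A flip needs a
    spare label as the common midpoint of the two diagonals. Therefore the surface conditions are
    stated for sets of faces over a type whose labels need not all be in use. *)

Lemma connect_map (T T' : finType) (e : rel T) (e' : rel T') (h : T -> T') x y :
  (forall x y, e x y -> connect e' (h x) (h y)) ->
  connect e x y -> connect e' (h x) (h y).
Proof.
move=> H /connectP [p pth ->]; elim: p x pth => [|z p IH] x //= /andP[xz /IH].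
exact: connect_trans (H _ _ xz).
Qed.

(** * Faces as ordered triples, and closed surfaces over a type with spare labels *)

Section FaceSets.
Variable T : finType.
Implicit Types (F : {set {set T}}) (f : {set T}) (x y z v a b m : T).

(** With ordered triples, [tri F v] is the adjacency relation of the link of [v], and [tri F x y] is
    the set of apices of the edge [xy]. *)
Definition tri F x y z := [&& x != y, y != z, x != z & [set x; y; z] \in F].

Definition edge F : rel T := [rel x y | [exists z, tri F x y z]].

(** Every clause speaks only of vertices on faces, so a label on no face is allowed. This leaves
    room in [T] for the vertices that subdivisions introduce. *)
Record surf F : Prop := Surf {
  surf_card : forall f, f \in F -> #|f| = 3;
  surf_edge : forall x y z, tri F x y z -> #|[set z' | tri F x y z']| = 2;
  surf_link : forall v x x' y y',
    tri F v x x' -> tri F v y y' -> connect (tri F v) x y;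
  surf_conn : forall x x' x'' y y' y'',
    tri F x x' x'' -> tri F y y' y'' -> connect (edge F) x y }.

Lemma set3CA x y z : [set x; y; z] = [set y; x; z].
Proof. by apply/setP=> i; rewrite !inE; do !case: (_ == _). Qed.

Lemma set3AC x y z : [set x; y; z] = [set x; z; y].
Proof. by apply/setP=> i; rewrite !inE; do !case: (_ == _). Qed.

Lemma tri12 F x y z : tri F x y z = tri F y x z.
Proof.
rewrite /tri set3CA (eq_sym x y).
by case: (y == x); case: (y == z); case: (x == z).
Qed.

Lemma tri23 F x y z : tri F x y z = tri F x z y.
Proof.
rewrite /tri set3AC (eq_sym z y).
by case: (x == y); case: (y == z); case: (x == z).
Qed.

Lemma tri13 F x y z : tri F x y z = tri F z y x.
Proof. by rewrite tri12 tri23 tri12. Qed.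

Lemma triR F x y z : tri F x y z = tri F z x y.
Proof. by rewrite tri23 tri12. Qed.

End FaceSets.

Ltac tri_perm t := solve
  [ exact t | rewrite tri12; exact t | rewrite tri23; exact t
  | rewrite tri13; exact t | rewrite triR; exact t
  | rewrite triR triR; exact t ].

Section Surfaces.
Variable T : finType.
Implicit Types (F : {set {set T}}) (f : {set T}) (x y z v a b m : T).

Lemma tri_neq F x y z :
  tri F x y z -> [/\ x != y, y != z & x != z].
Proof. by case/and4P. Qed.

Lemma tri_face F x y z : tri F x y z -> [set x; y; z] \in F.
Proof. by case/and4P. Qed.

Lemma tri_xx F x y : tri F x x y = false.
Proof. by rewrite /tri eqxx. Qed.

Lemma tri_xyx F x y : tri F x y x = false.
Proof. by rewrite /tri eqxx !andbF. Qed.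

Lemma tri_xyy F x y : tri F x y y = false.
Proof. by rewrite /tri eqxx !andbF. Qed.

Lemma card3P (f : {set T}) :
  reflect (exists x y z, [/\ x != y, y != z, x != z & f = [set x; y; z]])
          (#|f| == 3).
Proof.
apply: (iffP eqP) => [f3 | [x [y [z [xy yz xz ->]]]]]; last first.
  by rewrite setUC cardsU1 !inE cards2 xy (eq_sym z) (eq_sym z y) (negbTE xz) (negbTE yz).
have /card_gt0P[x xf] : 0 < #|f| by rewrite f3.
have := cardsD1 x f; rewrite xf f3 => -[] /esym /eqP /cards2P [y [z [yz fx]]].
have /setD1P[yx _] : y \in f :\ x by rewrite fx !inE eqxx.
have /setD1P[zx _] : z \in f :\ x by rewrite fx !inE eqxx orbT.
exists x, y, z; split; rewrite // 1?eq_sym //.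
by rewrite -(setD1K xf) fx setUA.
Qed.

Lemma face_tri F f : #|f| = 3 -> f \in F ->
  exists x y z, tri F x y z /\ f = [set x; y; z].
Proof.
move=> /eqP/card3P [x [y [z [xy yz xz ->]]]] fF; exists x, y, z; split=> //.
by rewrite /tri xy yz xz.
Qed.

Lemma tri_of_face F x y z : (forall f, f \in F -> #|f| = 3) ->
  [set x; y; z] \in F -> tri F x y z.
Proof.
move=> F3 fF; rewrite /tri fF andbT; move: (F3 _ fF) => h.
apply/and3P; split; apply: contraTneq (isT) => e; move: h; rewrite e.
- by rewrite setUid cards2; case: (_ != _).
- by rewrite -setUA setUid cards2; case: (_ != _).
- by rewrite set3AC setUid cards2; case: (_ != _).
Qed.

Lemma tri_mem F x y z f : #|f| = 3 -> f \in F -> x != y -> y != z -> x != z ->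
  x \in f -> y \in f -> z \in f -> tri F x y z /\ f = [set x; y; z].
Proof.
move=> f3 fF xy yz xz xf yf zf.
have e : f = [set x; y; z].
  apply/esym/eqP; rewrite eqEcard f3; apply/andP; split.
    by apply/subsetP=> i; rewrite !inE => /orP[/orP[]|] /eqP ->.
  by apply/eq_leq/esym/eqP/card3P; exists x, y, z.
by split=> //; rewrite /tri xy yz xz /= -e.
Qed.

Lemma surf_third F x y z : surf F -> tri F x y z ->
  exists z', z' != z /\ forall w, tri F x y w = (w == z) || (w == z').
Proof.
move=> sF t; have /eqP/cards2P [p [q [pq e]]] := surf_edge sF t.
have E w : tri F x y w = (w == p) || (w == q).
  by have := in_set (fun w => tri F x y w) w; rewrite e !inE => <-.
have: (z == p) || (z == q) by rewrite -E.
case/orP=> /eqP ->; first by exists q; rewrite eq_sym.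
by exists p; split=> // w; rewrite E orbC.
Qed.

Lemma surf_two F x y z z' w : surf F -> tri F x y z -> tri F x y z' -> z != z' ->
  tri F x y w -> w = z \/ w = z'.
Proof.
move=> sF t t' zz'; have [p [_ E]] := surf_third sF t.
move: t'; rewrite !E => /orP[/eqP e|/eqP e].
  by rewrite e eqxx in zz'.
by rewrite -e => /orP[/eqP|/eqP]; [left|right].
Qed.

Lemma link_sym F v : connect_sym (tri F v).
Proof. by apply: sym_connect_sym => x y; rewrite tri23. Qed.

Lemma edge_sym F : connect_sym (edge F).
Proof.
apply: sym_connect_sym => x y; apply/existsP/existsP => -[z t]; exists z;
  by rewrite tri12.
Qed.

Lemma tri_edge F x y z : tri F x y z -> edge F x y.
Proof. by move=> t; apply/existsP; exists z. Qed.

(** * Stellar subdivision of an edge *)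

(* The case [m \in f] makes [m |: (f :\ a)] and [m |: (f :\ b)] the new faces, for
   the faces [f] of [F] through [a] and [b]. *)
Definition subdiv F a b m : {set {set T}} :=
  [set f : {set T} | if m \in f then ((a \in f) (+) (b \in f)) && (a |: (b |: f :\ m) \in F)
           else (f \in F) && ~~ ((a \in f) && (b \in f))].

Section Subdiv.
Variables (F : {set {set T}}) (a b m : T).
Hypotheses (F3 : forall f, f \in F -> #|f| = 3).
Hypothesis (mF : forall f, f \in F -> m \notin f).
Hypotheses (ab : a != b) (am : a != m) (bm : b != m).
Let F' := subdiv F a b m.

Lemma tri_fresh x y : tri F m x y = false.
Proof.
apply/negP=> /and4P [_ _ _ /mF]; by rewrite !inE eqxx.
Qed.

Lemma tri_subdiv_old x y z : x != m -> y != m -> z != m ->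
  tri F' x y z = tri F x y z &&
     ~~ ([|| a == x, a == y | a == z] && [|| b == x, b == y | b == z]).
Proof.
move=> xm ym zm; rewrite /tri inE !inE !(eq_sym m) (negbTE xm) (negbTE ym) (negbTE zm) /=.
by rewrite -!orbA -!andbA.
Qed.

Lemma tri_subdiv_new x y :
  tri F' m x y = ((x == a) || (x == b)) && tri F a b y
              || ((y == a) || (y == b)) && tri F a b x.
Proof.
have [<-|xm] := eqVneq m x.
  by rewrite tri_xx (eq_sym m) (negbTE am) (eq_sym m) (negbTE bm) /= tri13 tri_fresh ?andbF.
have [<-|ym] := eqVneq m y.
  by rewrite tri_xyx (eq_sym m) (negbTE am) (eq_sym m) (negbTE bm) /= tri13 tri_fresh ?andbF.
have [<-|xy] := eqVneq x y.
  rewrite tri_xyy orbb; have [->|xa] /= := eqVneq x a; first by rewrite tri_xyx.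
  by have [->|xb] /= := eqVneq x b; first by rewrite tri_xyy.
rewrite {1}/tri inE !inE eqxx /= xm ym xy /=.
have -> : [set m; x; y] :\ m = [set x; y].
  apply/setP=> i; rewrite !inE; have [->|] //= := eqVneq i m.
  by rewrite (negbTE xm) (negbTE ym).
rewrite (negbTE am) (negbTE bm) /= !(eq_sym a) !(eq_sym b).
have [ex|xa] /= := eqVneq x a.
  rewrite ex in xy xm *; rewrite (eq_sym y a) (negbTE xy) /= (negbTE ab) /= tri_xyx andbF orbF.
  have [ey|yb] /= := eqVneq y b; first by rewrite ey tri_xyy.
  have -> : a |: (b |: [set a; y]) = [set a; b; y].
    by apply/setP=> i; rewrite !inE; do !case: (_ == _).
  by rewrite /tri ab xy eq_sym yb.
have [ex|xb] /= := eqVneq x b.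
  rewrite ex in xa xy *; rewrite tri_xyy andbF orbF.
  have [ey|ya] /= := eqVneq y a; first by rewrite ey tri_xyx.
  have -> : a |: (b |: [set b; y]) = [set a; b; y].
    by apply/setP=> i; rewrite !inE; do !case: (_ == _).
  by rewrite /tri ab xy eq_sym ya.
have [ey|ya] /= := eqVneq y a.
  rewrite ey (negbTE ab) /=; have -> : a |: (b |: [set x; a]) = [set a; b; x].
    by apply/setP=> i; rewrite !inE; do !case: (_ == _).
  by rewrite /tri ab (eq_sym b) xb (eq_sym a) xa.
have [ey|yb] //= := eqVneq y b.
rewrite ey; have -> : a |: (b |: [set x; b]) = [set a; b; x].
  by apply/setP=> i; rewrite !inE; do !case: (_ == _).
by rewrite /tri ab (eq_sym b) xb (eq_sym a) xa.
Qed.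

Lemma tri_subdiv_abF z : tri F' a b z = false.
Proof.
have [->|zm] := eqVneq z m; last by rewrite tri_subdiv_old // !eqxx !orbT andbF.
by rewrite tri13 tri_subdiv_new tri_xyx tri_xyy !andbF.
Qed.

Lemma subdiv_card f : f \in F' -> #|f| = 3.
Proof.
rewrite inE; case: ifP => [mf /andP[abf ff]|mf /andP[/F3]] //.
have h : #|a |: (b |: f :\ m)| = #|f|.
  have := cardsD1 m f; rewrite mf /= => ->.
  rewrite cardsU1 cardsU1 !inE (negbTE ab) am bm /=.
  by case: (a \in f) abf; case: (b \in f).
by rewrite -h F3.
Qed.

Lemma subdiv_apices_ma : [set z | tri F' m a z] = [set z | tri F a b z].
Proof.
apply/setP=> z; rewrite !inE tri_subdiv_new eqxx /=.
by rewrite tri_xyx andbF orbF.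
Qed.

Lemma subdiv_apices_mb : [set z | tri F' m b z] = [set z | tri F a b z].
Proof.
by apply/setP=> z; rewrite !inE tri_subdiv_new eqxx orbT /= tri_xyy andbF orbF.
Qed.

Lemma subdiv_apices_m y : y != a -> y != b -> tri F a b y ->
  [set z | tri F' m y z] = [set a; b].
Proof.
move=> ya yb t; apply/setP=> z; rewrite !inE tri_subdiv_new (negbTE ya) (negbTE yb) /=.
by rewrite t andbT.
Qed.

(** Other edges keep the number of their apices: [ay] with apex [b] and [by] with apex [a] get [m]
    instead, and all remaining apices stay. *)
Lemma subdiv_apices x y : x != m -> y != m ->
  ~~ ((x == a) && (y == b)) -> ~~ ((x == b) && (y == a)) ->
  #|[set z | tri F' x y z]| = #|[set z | tri F x y z]|.
Proof.
move=> xm ym.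
(* At most one end of a proper edge other than [ab] is [a] or [b]; by symmetry it is [x]. *)
wlog: x y xm ym / ~~ ((y == a) || (y == b)) => [hw n1 n2|].
  case: (boolP ((y == a) || (y == b))) => [hy|hy]; last exact: hw.
  have [exy|xy] := eqVneq x y.
    by rewrite exy; apply: eq_card => z; rewrite !inE !tri_xx.
  have hx : ~~ ((x == a) || (x == b)).
    apply/negP => hx; move: n1 n2 xy.
    by case/orP: hx => /eqP ->; case/orP: hy => /eqP ->; rewrite !eqxx //= ?andbT.
  have := hw y x ym xm hx; rewrite (andbC (y == b)) (andbC (y == a)) => /(_ n2 n1) E.
  rewrite -[RHS](_ : #|[set z | tri F y x z]| = _); last first.
    by apply: eq_card => z; rewrite !inE tri12.
  by rewrite -E; apply: eq_card => z; rewrite !inE tri12.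
rewrite negb_or => /andP[ya yb] _ _.
pose r z := if (x == a) && (z == b) || (x == b) && (z == a) then m else z.
have -> : [set z | tri F' x y z] = r @: [set z | tri F x y z].
  apply/setP=> z; rewrite inE; apply/idP/imsetP => [t | [z0]].
    have [ez|zm] := eqVneq z m.
      move: t; rewrite ez triR tri_subdiv_new.
      rewrite (negbTE ya) (negbTE yb) /= orbF => /andP[/orP[/eqP ex|/eqP ex] t].
        exists b; last by rewrite /r ex !eqxx.
        by rewrite inE ex tri23.
      exists a; last by rewrite /r ex !eqxx orbT.
      by rewrite inE ex triR.
    move: t; rewrite tri_subdiv_old // => /andP[t nab].
    exists z; first by rewrite inE.
    rewrite /r ifN //; apply: contra nab.
    by case/orP=> /andP[/eqP -> /eqP ->]; rewrite !eqxx !orbT.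
  rewrite inE /r; case: ifP => [c t ->|/negbT c t ->].
    rewrite triR tri_subdiv_new; move: t.
    case/orP: c => /andP[/eqP -> /eqP ->]; rewrite eqxx ?orbT /=.
      by rewrite tri23 => ->.
    by rewrite triR => ->.
  have zm : z0 != m by apply: contraTneq t => ->; rewrite tri13 tri_fresh.
  rewrite tri_subdiv_old // t /=; apply: contra c.
  rewrite (eq_sym a y) (negbTE ya) (eq_sym b y) (negbTE yb) /=.
  rewrite !(eq_sym a) !(eq_sym b); case/andP=> /orP[] /eqP e1 /orP[] /eqP e2.
  - by move: ab; rewrite -e1 -e2 eqxx.
  - by rewrite e1 e2 !eqxx.
  - by rewrite e1 e2 !eqxx orbT.
  - by move: ab; rewrite -e1 -e2 eqxx.
rewrite card_in_imset // => z z'; rewrite !inE => t t'.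
have zm : z != m by apply: contraTneq t => ->; rewrite tri13 tri_fresh.
have zm' : z' != m by apply: contraTneq t' => ->; rewrite tri13 tri_fresh.
rewrite /r; case: ifP => [c|_]; case: ifP => [c'|_] //.
- move=> _; move: c c' => /orP[] /andP[/eqP -> /eqP ->]; rewrite eqxx ?(negbTE ab) ?(eq_sym b a) ?(negbTE ab) /= ?orbF.
    by move/eqP.
  by move/eqP.
- by move=> e; rewrite e eqxx in zm'.
- by move=> e; rewrite e eqxx in zm.
Qed.

(** Seen from [a], the neighbor in the direction of [b] is now [m], and likewise with [a] and [b]
    exchanged. *)
Let away v x := if (v == a) && (x == b) || (v == b) && (x == a) then m else x.

Lemma tri_fresh_neq x y z : tri F x y z -> [/\ x != m, y != m & z != m].
Proof.
move=> t; split; apply: contraTneq t => ->; rewrite ?tri_fresh //.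
  by rewrite tri12 tri_fresh.
by rewrite triR tri_fresh.
Qed.

Lemma subdiv_tri_ma y : tri F a b y -> tri F' m a y.
Proof. by move=> t; rewrite tri_subdiv_new eqxx t. Qed.

Lemma subdiv_tri_mb y : tri F a b y -> tri F' m b y.
Proof. by move=> t; rewrite tri_subdiv_new eqxx t orbT. Qed.

Lemma subdiv_tri_mP x y : tri F' m x y ->
  (x = a \/ x = b) /\ tri F a b y \/ (y = a \/ y = b) /\ tri F a b x.
Proof.
rewrite tri_subdiv_new => /orP[] /andP[/orP e t]; [left | right];
  by split=> //; case: e => /eqP; [left | right].
Qed.

(** A link edge stays a link edge, except for the edge [ab] in the link of an apex of [ab], which
    becomes the path through [m]. *)
Lemma subdiv_link_fwd v x y : tri F v x y ->
  tri F' v (away v x) (away v y) \/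
  [/\ away v x = x, away v y = y, tri F' v x m & tri F' v m y].
Proof.
move=> t; have [vm xm ym] := tri_fresh_neq t; have [vx xy vy] := tri_neq t.
rewrite /away.
have [ev|va] /= := eqVneq v a.
  rewrite {}ev (negbTE ab) /= !orbF in t vx vy *; left.
  have [ex|xb] := eqVneq x b.
    rewrite {}ex in xy t *; rewrite (eq_sym y) (negbTE xy).
    by have t' := subdiv_tri_ma t; tri_perm t'.
  have [ey|yb] := eqVneq y b.
    rewrite {}ey tri23 in t; by have t' := subdiv_tri_ma t; tri_perm t'.
  rewrite tri_subdiv_old ?am // t /= (eq_sym b a) (negbTE ab) (eq_sym b x) (negbTE xb).
  by rewrite (eq_sym b y) (negbTE yb) andbF.
have [ev|vb] /= := eqVneq v b.
  rewrite {}ev in t vx vy *; left.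
  have [ex|xa] := eqVneq x a.
    rewrite {}ex tri12 in xy t *; rewrite (eq_sym y) (negbTE xy).
    by have t' := subdiv_tri_mb t; tri_perm t'.
  have [ey|ya] := eqVneq y a.
    rewrite {}ey triR in t; by have t' := subdiv_tri_mb t; tri_perm t'.
  rewrite tri_subdiv_old // t /= (negbTE ab) (eq_sym a x) (negbTE xa).
  by rewrite (eq_sym a y) (negbTE ya).
case: (boolP ([|| a == v, a == x | a == y] && [|| b == v, b == x | b == y])) => h; last first.
  by left; rewrite tri_subdiv_old // t h.
right; move: h; rewrite (eq_sym a v) (negbTE va) (eq_sym b v) (negbTE vb) /=.
case/andP=> /orP[] /eqP ea /orP[] /eqP eb; move: ab xy; rewrite ea eb ?eqxx // -ea -eb => _ _.
  have t0 : tri F a b v by rewrite ea eb; tri_perm t.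
  have t1 := subdiv_tri_ma t0; have t2 := subdiv_tri_mb t0.
  by split=> //; [tri_perm t1 | tri_perm t2].
have t0 : tri F a b v by rewrite ea eb; tri_perm t.
have t1 := subdiv_tri_ma t0; have t2 := subdiv_tri_mb t0.
by split=> //; [tri_perm t2 | tri_perm t1].
Qed.

Lemma subdiv_link_bwd v x x' : v != m -> tri F' v x x' ->
  exists x0 x0', tri F v x0 x0' /\ connect (tri F' v) x (away v x0).
Proof.
move=> vm t; have [vx xx vx'] := tri_neq t.
have [ex|xm] := eqVneq x m.
  rewrite {}ex in t vx xx *; have t1 : tri F' m v x' by tri_perm t.
  case: (subdiv_tri_mP t1) => -[[] e t2]; rewrite {}e in t t1 vx vx' xx *.
  - by exists b, x'; split=> //; rewrite /away !eqxx.
  - by exists a, x'; split; [tri_perm t2 | rewrite /away !eqxx orbT].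
  - exists a, b; split; first by tri_perm t2.
    have [_ bv av] := tri_neq t2.
    by rewrite /away !(eq_sym v) (negbTE av) (negbTE bv) /=; exact: connect1.
  - exists b, a; split; first by tri_perm t2.
    have [_ bv av] := tri_neq t2.
    by rewrite /away !(eq_sym v) (negbTE av) (negbTE bv) /=; exact: connect1.
have [ex'|x'm] := eqVneq x' m.
  rewrite {}ex' in t vx' xx *; have t1 : tri F' m v x by tri_perm t.
  case: (subdiv_tri_mP t1) => -[[] e t2]; rewrite {}e in t t1 vx vx' xx *.
  - exists x, b; split; first by tri_perm t2.
    have [_ bx ax] := tri_neq t2.
    by rewrite /away (negbTE ab) (eq_sym x) (negbTE bx) andbF.
  - exists x, a; split; first by tri_perm t2.
    have [_ bx ax] := tri_neq t2.
    by rewrite /away (eq_sym b a) (negbTE ab) (eq_sym x a) (negbTE ax) andbF.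
  - exists a, b; split; first by tri_perm t2.
    have [_ bx ax] := tri_neq t2.
    by rewrite /away (eq_sym v a) (negbTE ax) (eq_sym v b) (negbTE bx).
  - exists b, a; split; first by tri_perm t2.
    have [_ bx ax] := tri_neq t2.
    by rewrite /away (eq_sym v a) (negbTE ax) (eq_sym v b) (negbTE bx).
move: t; rewrite tri_subdiv_old // => /andP[t nab].
exists x, x'; split=> //; rewrite /away ifN //; apply: contra nab.
by case/orP=> /andP[/eqP -> /eqP ->]; rewrite !eqxx ?orbT.
Qed.

(** A left inverse of [away v] on old vertices. In the link of an apex of [ab], where [m] lies
    between [a] and [b], it collapses [m] onto the end [a]. *)
Let back v x := if x == m then if v == a then b else a else x.

Lemma back_away v x : x != m -> back v (away v x) = x.
Proof.
move=> xm; rewrite /back /away; have [->|va] := eqVneq v a; rewrite ?(negbTE ab) /= ?orbF.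
  by have [->|_] := eqVneq x b; rewrite ?eqxx // (negbTE xm).
have [_|vb] /= := eqVneq v b; last by rewrite (negbTE xm).
by have [->|_] := eqVneq x a; rewrite ?eqxx // (negbTE xm).
Qed.

Lemma subdiv_link_back v x y : v != m -> tri F' v x y ->
  connect (tri F v) (back v x) (back v y).
Proof.
move=> vm; wlog ym : x y / y != m => [hw t|t].
  have [ey|ym] := eqVneq y m; last exact: hw.
  have [_ xy _] := tri_neq t.
  by rewrite link_sym; apply: hw; rewrite -?ey // tri23 ey in t *.
have [vx xy vy] := tri_neq t.
rewrite /back (negbTE ym); have [ex|xm] := eqVneq x m; last first.
  by move: t; rewrite tri_subdiv_old // => /andP[t _]; apply: connect1.
rewrite {}ex in t vx xy; have t1 : tri F' m v y by tri_perm t.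
case: (subdiv_tri_mP t1) => -[[] e t2].
- by rewrite e eqxx; apply: connect1.
- rewrite e (eq_sym b a) (negbTE ab); apply: connect1; by tri_perm t2.
- by rewrite -e eq_sym ifN ?connect0 // eq_sym.
- have [_ _ av] := tri_neq t2; rewrite eq_sym (negbTE av) e; apply: connect1; by tri_perm t2.
Qed.

Lemma card_apicesC (G : {set {set T}}) x y :
  #|[set z | tri G x y z]| = #|[set z | tri G y x z]|.
Proof. by apply: eq_card => z; rewrite !inE tri12. Qed.

Lemma apices_gt0 (G : {set {set T}}) x y z :
  tri G x y z -> 0 < #|[set z | tri G x y z]|.
Proof. by move=> t; apply/card_gt0P; exists z; rewrite inE. Qed.

Lemma subdiv_not_ab x y z : tri F' x y z ->
  ~~ ((x == a) && (y == b)) /\ ~~ ((x == b) && (y == a)).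
Proof.
move=> t; split; apply/negP=> /andP[/eqP ex /eqP ey]; move: t; rewrite ex ey.
  by rewrite tri_subdiv_abF.
by rewrite tri12 tri_subdiv_abF.
Qed.

Variable c : T.
Hypothesis abc : tri F a b c.

Lemma surf_subdiv : surf F -> surf F'.
Proof.
move=> sF; split.
- exact: subdiv_card.
- have key y z : tri F' m y z -> #|[set z' | tri F' m y z']| = 2.
    move=> t; case: (subdiv_tri_mP t) => -[[] e t2].
    + by rewrite e subdiv_apices_ma (surf_edge sF t2).
    + by rewrite e subdiv_apices_mb (surf_edge sF t2).
    + have [_ bx ax] := tri_neq t2.
      by rewrite subdiv_apices_m ?cards2 ?ab // eq_sym.
    + have [_ bx ax] := tri_neq t2.
      by rewrite subdiv_apices_m ?cards2 ?ab // eq_sym.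
  move=> x y z t; have [ex|xm] := eqVneq x m.
    by rewrite ex in t *; exact: key t.
  have [ey|ym] := eqVneq y m.
    by rewrite card_apicesC; rewrite ey tri12 in t *; exact: key t.
  have [n1 n2] := subdiv_not_ab t.
  have := apices_gt0 t; rewrite subdiv_apices // => /card_gt0P [w].
  by rewrite inE; exact: surf_edge.
- move=> v x x' y y' tx ty; have [ev|vm] := eqVneq v m.
    (* The link of [m] consists of [a], [b] and the apices of [ab], and all of them reach [a]. *)
    have key z z' : tri F' m z z' -> connect (tri F' m) z a.
      move=> t; case: (subdiv_tri_mP t) => -[[] e t2].
      + by rewrite e.
      + rewrite e; apply: (@connect_trans _ _ z'); apply: connect1.
          exact: subdiv_tri_mb.
        by rewrite tri23; exact: subdiv_tri_ma.
      + by apply: connect1; rewrite -e.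
      + by apply: connect1; rewrite tri23; apply: subdiv_tri_ma.
    rewrite ev in tx ty *; apply: connect_trans (key _ _ tx) _.
    by rewrite link_sym; exact: key ty.
  have [x0 [x1 [tx0 cx]]] := subdiv_link_bwd vm tx.
  have [y0 [y1 [ty0 cy]]] := subdiv_link_bwd vm ty.
  apply: connect_trans cx _; rewrite link_sym; apply: connect_trans cy _.
  apply: (connect_map (h := away v)) (surf_link sF ty0 tx0) => z w t.
  case: (subdiv_link_fwd t) => [t'|[-> -> t1 t2]]; first exact: connect1.
  exact: connect_trans (connect1 t1) (connect1 t2).
- have key x x' x'' : tri F' x x' x'' -> exists x0 x1 x2,
      tri F x0 x1 x2 /\ connect (edge F') x x0.
    move=> t; have [ex|xm] := eqVneq x m.
      exists a, b, c; split=> //; apply: connect1; rewrite ex.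
      exact: tri_edge (subdiv_tri_ma abc).
    have [x1 [x2 [t2 _]]] := subdiv_link_bwd xm t.
    by exists x, x1, x2.
  move=> x x' x'' y y' y'' /key [x0 [x1 [x2 [tx cx]]]] /key [y0 [y1 [y2 [ty cy]]]].
  apply: connect_trans cx _; rewrite edge_sym; apply: connect_trans cy _.
  apply: (connect_map (h := id)) (surf_conn sF ty tx) => z w /existsP [r t].
  have am' := subdiv_tri_ma abc; have bm' := subdiv_tri_mb abc.
  (* The lost edge [ab] is replaced by the path through [m]. *)
  case: (boolP ((z == a) && (w == b))) => [/andP[/eqP -> /eqP ->]|n1].
    apply: (@connect_trans _ _ m); last exact: connect1 (tri_edge bm').
    by rewrite edge_sym; exact: connect1 (tri_edge am').
  case: (boolP ((z == b) && (w == a))) => [/andP[/eqP -> /eqP ->]|n2].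
    apply: (@connect_trans _ _ m); last exact: connect1 (tri_edge am').
    by rewrite edge_sym; exact: connect1 (tri_edge bm').
  have [zm wm rm] := tri_fresh_neq t.
  have := apices_gt0 t; rewrite -subdiv_apices // => /card_gt0P [q].
  by rewrite inE => tq; exact: connect1 (tri_edge tq).
Qed.

(** This direction serves for flips: the flipped complex is first known to be a surface after
    subdivision of its new diagonal, and the midpoint has to be removed again. *)
Lemma surf_unsubdiv : surf F' -> surf F.
Proof.
move=> sF; split.
- exact: F3.
- move=> x y z t; have [xm ym zm] := tri_fresh_neq t.
  case: (boolP ((x == a) && (y == b))) => [/andP[/eqP ex /eqP ey]|n1].
    rewrite ex ey in t *; rewrite -subdiv_apices_ma.
    exact: surf_edge (subdiv_tri_ma t).
  case: (boolP ((x == b) && (y == a))) => [/andP[/eqP ex /eqP ey]|n2].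
    rewrite ex ey tri12 in t *; rewrite card_apicesC -subdiv_apices_ma.
    exact: surf_edge (subdiv_tri_ma t).
  have := apices_gt0 t; rewrite -subdiv_apices // => /card_gt0P [w].
  by rewrite inE; exact: surf_edge.
- have key v x x' : tri F v x x' -> exists w, tri F' v (away v x) w.
    by case/subdiv_link_fwd => [t'|[-> _ t _]]; [exists (away v x') | exists m].
  move=> v x x' y y' tx ty.
  have [vm xm _] := tri_fresh_neq tx; have [_ ym _] := tri_fresh_neq ty.
  have [x1 tx1] := key _ _ _ tx; have [y1 ty1] := key _ _ _ ty.
  rewrite -(back_away v xm) -(back_away v ym).
  by apply: (connect_map (h := back v)) (surf_link sF tx1 ty1) => z w; exact: subdiv_link_back.
- pose bk x := if x == m then a else x.
  have key x y z : tri F' x y z -> y != m -> connect (edge F) (bk x) y.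
    move=> t ym; rewrite /bk; have [ex|xm] := eqVneq x m.
      rewrite ex in t; case: (subdiv_tri_mP t) => -[[] e t2].
      + by rewrite e.
      + by rewrite e; exact: connect1 (tri_edge abc).
      + by apply: connect1; apply: (@tri_edge _ _ _ b); tri_perm t2.
      + by apply: connect1; apply: (@tri_edge _ _ _ b); tri_perm t2.
    have [n1 n2] := subdiv_not_ab t.
    have := apices_gt0 t; rewrite subdiv_apices // => /card_gt0P [w].
    by rewrite inE => /tri_edge; exact: connect1.
  have used x x' x'' : tri F x x' x'' -> exists w w', tri F' x w w'.
    case/subdiv_link_fwd => [t'|[_ _ t _]]; first by exists (away x x'), (away x x'').
    by exists x', m.
  move=> x x' x'' y y' y'' tx ty.
  have [xm _ _] := tri_fresh_neq tx; have [ym _ _] := tri_fresh_neq ty.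
  have [x1 [x2 tx1]] := used _ _ _ tx; have [y1 [y2 ty1]] := used _ _ _ ty.
  have -> : x = bk x by rewrite /bk (negbTE xm).
  have -> : y = bk y by rewrite /bk (negbTE ym).
  apply: (connect_map (h := bk)) (surf_conn sF tx1 ty1) => z w /existsP [q t].
  have [ew|wm] := eqVneq w m; last first.
    by rewrite {2}/bk (negbTE wm); exact: key t wm.
  have [zw _ _] := tri_neq t.
  rewrite edge_sym {2}/bk ifN -?ew //; apply: (key _ _ q); rewrite -?ew //.
  by rewrite tri12.
Qed.

End Subdiv.
End Surfaces.

(** * Edge flips *)

Section Flips.
Variable T : finType.
Implicit Types (F : {set {set T}}) (f : {set T}) (x y z v a b c d m : T).

Lemma eq_faces F F' : (forall f, f \in F -> #|f| = 3) ->
  (forall f, f \in F' -> #|f| = 3) ->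
  (forall x y z, tri F x y z = tri F' x y z) -> F = F'.
Proof.
move=> F3 F3' E; apply/setP=> f; apply/idP/idP => fF.
  have [x [y [z [t ->]]]] := face_tri (F3 _ fF) fF.
  by rewrite E in t; exact: tri_face t.
have [x [y [z [t ->]]]] := face_tri (F3' _ fF) fF.
by rewrite -E in t; exact: tri_face t.
Qed.

Definition flip F a b c d :=
  (F :\: [set [set a; b; c]; [set a; b; d]])
    :|: [set [set c; d; a]; [set c; d; b]].

Lemma set3_card x y z : x != y -> y != z -> x != z -> #|[set x; y; z]| = 3.
Proof. by move=> ? ? ?; apply/eqP/card3P; exists x, y, z. Qed.

Lemma third_vertex F f a b : f \in F -> #|f| = 3 -> a \in f -> b \in f -> a != b ->
  exists e, tri F a b e /\ f = [set a; b; e].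
Proof.
move=> fF f3 af bf ab.
have := cardsD1 a f; rewrite af f3 => -[] /esym.
rewrite (cardsD1 b (f :\ a)) !inE bf eq_sym ab => -[]; rewrite add0n => fab.
have /card_gt0P [e] : 0 < #|f :\ a :\ b| by rewrite fab.
rewrite !inE => /and3P[eb ea ef]; exists e.
by apply: tri_mem => //; rewrite eq_sym.
Qed.

Lemma edge_two F f a b c d : f \in F -> #|f| = 3 -> a != b ->
  (forall x, tri F a b x -> x = c \/ x = d) ->
  (a \in f) && (b \in f) = (f \in [set [set a; b; c]; [set a; b; d]]).
Proof.
move=> fF f3 ab abE; apply/idP/idP => [/andP[af bf]|].
  have [e [t ->]] := third_vertex fF f3 af bf ab.
  by rewrite inE !in_set1; case: (abE _ t) => ->; rewrite eqxx ?orbT.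
by rewrite inE !in_set1 => /orP[] /eqP ->; rewrite !inE !eqxx ?orbT.
Qed.

Section Flip.
Variables (F : {set {set T}}) (a b c d m : T).
Hypotheses (F3 : forall f, f \in F -> #|f| = 3).
Hypothesis (mF : forall f, f \in F -> m \notin f).
Hypotheses (am : a != m) (bm : b != m) (cm : c != m) (dm : d != m).
Hypotheses (cd : c != d).
Hypotheses (abc : tri F a b c) (abd : tri F a b d).
Hypotheses (abE : forall x, tri F a b x -> x = c \/ x = d).
Hypotheses (cdE : forall x, tri F c d x = false).

Lemma flip_card f : f \in flip F a b c d -> #|f| = 3.
Proof.
have [ab bc ac] := tri_neq abc; have [_ bd ad] := tri_neq abd.
rewrite !inE => /orP[/andP[_ /F3] //|].
by case/orP=> /eqP ->; rewrite set3_card // eq_sym.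
Qed.

Lemma flip_fresh f : f \in flip F a b c d -> m \notin f.
Proof.
rewrite !inE => /orP[/andP[_ /mF] //|].
case/orP=> /eqP ->; rewrite !inE !(eq_sym m) !negb_or ?am ?bm ?cm ?dm //.
Qed.

Lemma flip_tri_cd x : tri (flip F a b c d) c d x = (x == a) || (x == b).
Proof.
have [ab bc ac] := tri_neq abc; have [_ bd ad] := tri_neq abd.
apply/idP/idP => [t|].
  have [_ dx cx] := tri_neq t; have := tri_face t.
  rewrite inE in_setD => /orP[/andP[_ h]|].
    by have := cdE x; rewrite /tri cd dx cx h.
  rewrite !inE => /orP[] /eqP e; have : x \in [set c; d; x] by rewrite !inE eqxx ?orbT.
    by rewrite e !inE ![x == c]eq_sym ![x == d]eq_sym (negbTE cx) (negbTE dx) /= => ->.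
  by rewrite e !inE ![x == c]eq_sym ![x == d]eq_sym (negbTE cx) (negbTE dx) /= => ->; rewrite orbT.
by case/orP=> /eqP ->; rewrite /tri cd eq_sym 1?(eq_sym c) ?ad ?ac ?bd ?bc inE /= !inE eqxx ?orbT.
Qed.

(** Both sides fill the quadrilateral [acbd] with the cone from [m] over its four sides, whichever
    diagonal [m] is the midpoint of. As [cd] is no edge of [F], subdividing it touches only the two
    faces added by the flip. *)
Lemma flip_subdiv : subdiv (flip F a b c d) c d m = subdiv F a b m.
Proof.
have [ab bc ac] := tri_neq abc; have [_ bd ad] := tri_neq abd.
have abxE x : tri F a b x = (x == c) || (x == d).
  apply/idP/idP => [/abE[->|->]|]; rewrite ?eqxx ?orbT //.
  by case/orP=> /eqP ->.
apply: eq_faces.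
- exact: subdiv_card (flip_card) cd cm dm.
- exact: subdiv_card F3 ab am bm.
have key x y : tri (subdiv (flip F a b c d) c d m) m x y = tri (subdiv F a b m) m x y.
  (* Exchanging [{a, b}] with [{c, d}] exchanges the two disjuncts of [tri_subdiv_new]. *)
  rewrite !tri_subdiv_new //; [|exact: flip_fresh]; rewrite !flip_tri_cd !abxE.
  by rewrite orbC; congr (_ || _); rewrite andbC.
move=> x y z; have [->|xm] := eqVneq x m; first exact: key.
have [->|ym] := eqVneq y m; first by rewrite tri12 key tri12.
have [->|zm] := eqVneq z m; first by rewrite triR key -triR.
rewrite /tri; have [//|xy] := eqVneq x y; have [//|yz] := eqVneq y z.
have [//|xz] /= := eqVneq x z.
set f := [set x; y; z].
have mf : m \notin f by rewrite !inE !(eq_sym m) (negbTE xm) (negbTE ym) (negbTE zm).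
have f3 : #|f| = 3 by apply: set3_card.
clearbody f; rewrite inE (negbTE mf) [RHS]inE (negbTE mf).
rewrite inE in_setD.
have cdf : f \in F -> (c \in f) && (d \in f) = false.
  move=> fF; apply/negP => /andP[cf df].
  have [e [t _]] := third_vertex fF f3 cf df cd.
  by rewrite cdE in t.
have abf : f \in F -> (a \in f) && (b \in f) = (f \in [set [set a; b; c]; [set a; b; d]]).
  by move=> fF; exact: (edge_two fF f3 ab abE).
case: (boolP (f \in F)) => [fF | nF] /=.
  rewrite cdf // andbT abf // andbT.
  case: (boolP (f \in [set [set c; d; a]; _])) => [|_]; last by rewrite orbF.
  rewrite inE !in_set1 => /orP[] /eqP e; move: (cdf fF); rewrite e !inE !eqxx ?orbT //.
rewrite andbF /=; apply/negP => /andP[]; rewrite inE !in_set1 => /orP[] /eqP -> /negP[];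
  by rewrite !inE !eqxx ?orbT.
Qed.

Lemma surf_flip : surf F -> surf (flip F a b c d).
Proof.
move=> sF; have [ab _ _] := tri_neq abc.
apply: (surf_unsubdiv flip_card flip_fresh cd cm dm (c := a)).
  by rewrite flip_tri_cd eqxx.
rewrite flip_subdiv; exact: surf_subdiv F3 mF ab am bm _ abc sF.
Qed.

(** The explicit list of faces makes it possible to compare the end of a chain of moves with
    [split_faces]. *)
Lemma subdivE : subdiv F a b m = (F :\: [set [set a; b; c]; [set a; b; d]])
  :|: [set [set m; a; c]; [set m; b; c]; [set m; a; d]; [set m; b; d]].
Proof.
have [ab bc ac] := tri_neq abc; have [_ bd ad] := tri_neq abd.
have abf f : f \in F -> (a \in f) && (b \in f) = (f \in [set [set a; b; c]; [set a; b; d]]).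
  by move=> fF; exact: (edge_two fF (F3 fF) ab abE).
apply/setP=> f; rewrite inE in_setU in_setD; case: ifP => mf; last first.
  have -> : f \in [set [set m; a; c]; [set m; b; c]; [set m; a; d]; [set m; b; d]] = false.
    apply/negP; rewrite !in_setU !in_set1 => h; move/negP: mf; apply.
    by case/orP: h => [/orP[/orP[]|]|] /eqP ->; rewrite !inE eqxx.
  rewrite orbF andbC; case: (boolP (f \in F)) => fF; last by rewrite !andbF.
  by rewrite abf.
have nF : f \in F = false by apply/negP=> /mF; rewrite mf.
rewrite nF andbF /=; apply/idP/idP => [h|].
  have fs : f \in subdiv F a b m by rewrite inE mf.
  have f3 := subdiv_card F3 ab am bm fs.
  have := cardsD1 m f; rewrite mf f3 => -[] /esym /eqP /cards2P [x [y [xy fx]]].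
  have /setD1P[xm xf] : x \in f :\ m by rewrite fx !inE eqxx.
  have /setD1P[ym yf] : y \in f :\ m by rewrite fx !inE eqxx orbT.
  have [t ->] : tri (subdiv F a b m) m x y /\ f = [set m; x; y].
    by apply: tri_mem => //; rewrite eq_sym.
  case: (subdiv_tri_mP mF ab am bm t) => -[e /abE e'].
    by case: e e' => -> [] ->; rewrite !inE !eqxx ?orbT.
  rewrite set3AC; by case: e e' => -> [] ->; rewrite !inE !eqxx ?orbT.
have H1 y : tri F a b y -> [set m; a; y] \in subdiv F a b m.
  by move/(subdiv_tri_ma mF ab am bm)/tri_face.
have H2 y : tri F a b y -> [set m; b; y] \in subdiv F a b m.
  by move/(subdiv_tri_mb mF ab am bm)/tri_face.
suff H : f \in [set [set m; a; c]; [set m; b; c]; [set m; a; d]; [set m; b; d]] ->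
  f \in subdiv F a b m by move=> /H; rewrite inE mf.
rewrite !in_setU !in_set1 => /orP[/orP[/orP[]|]|] /eqP ->; auto.
Qed.

End Flip.

(** * P-splittings through subdivision and flips *)

Definition split_faces F v w x y z u :=
  (F :\: [set [set v; w; x]; [set v; x; y]; [set v; y; z]])
  :|: [set [set v; w; z]; [set u; w; z]; [set u; w; x]; [set u; x; y]; [set u; y; z]].

Lemma neq_mem f (g : {set T}) p : p \in f -> p \notin g -> (f == g) = false.
Proof. by move=> pf pg; apply: contraNF pg => /eqP <-. Qed.

Lemma neq_notin f (g : {set T}) p : p \notin f -> p \in g -> (f == g) = false.
Proof. by move=> pf pg; apply: contraNF pf => /eqP ->. Qed.

Section Split.
Variables (F : {set {set T}}) (v w x y z u m : T).
Hypothesis (sF : surf F).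
Hypotheses (uF : forall f, f \in F -> u \notin f) (mF : forall f, f \in F -> m \notin f).
Hypothesis (um : u != m).
Hypotheses (vwx : tri F v w x) (vxy : tri F v x y) (vyz : tri F v y z).
Hypotheses (wy : w != y) (wz : w != z) (xz : x != z).
Hypothesis (wzE : ~~ edge F w z).

(** On [vx], the vertex [u] starts with neighbors [v], [w], [x], [y]. Flipping [vy] to [uz] adds [z]
    to them, and flipping [uv] to [wz] removes [v]. The label [m] is the spare midpoint for both
    flips. *)
Let F1 := subdiv F v x u.
Let F2 := flip F1 v y u z.
Let F3 := flip F2 u v w z.

Lemma split_facesE : F3 = split_faces F v w x y z u.
Proof.
have [vw wx vx] := tri_neq vwx; have [_ xy vy] := tri_neq vxy; have [_ yz vz] := tri_neq vyz.
have [vu wu xu] := tri_fresh_neq uF vwx; have [_ _ yu] := tri_fresh_neq uF vxy.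
have [_ _ zu] := tri_fresh_neq uF vyz.
have vxw : tri F v x w by rewrite tri23.
have E1 : F1 = (F :\: [set [set v; x; w]; [set v; x; y]])
  :|: [set [set u; v; w]; [set u; x; w]; [set u; v; y]; [set u; x; y]].
  rewrite /F1 (subdivE (surf_card sF) uF _ _ vxw vxy) // => p.
  exact: surf_two sF vxw vxy wy.
rewrite /F3 /F2 E1 /flip /split_faces.
have S1 (p q r : T) : [set p; q; r] = [set q; r; p].
  by apply/setP=> i; rewrite !inE; do !case: (_ == _).
rewrite (set3AC v x w) (set3AC u x w) (S1 v y u) (S1 y u v) (set3AC u z v).
rewrite (S1 w z u) (S1 z u w) (S1 w z v) (S1 z v w) (set3AC u z y).
apply/setP=> f; rewrite !(in_setU, in_setD, in_set1).
have nv a b c : a != v -> b != v -> c != v -> v \notin [set a; b; c].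
  by move=> *; rewrite !inE !(eq_sym v) !negb_or -andbA; apply/and3P.
have nu a b c : a != u -> b != u -> c != u -> u \notin [set a; b; c].
  by move=> *; rewrite !inE !(eq_sym u) !negb_or -andbA; apply/and3P.
have iv a b : v \in [set v; a; b] by rewrite !inE eqxx.
have iv' a b : v \in [set a; v; b] by rewrite !inE eqxx orbT.
have iu a b : u \in [set u; a; b] by rewrite !inE eqxx.
have uv : u != v by rewrite eq_sym.
have wv : w != v by rewrite eq_sym.
have xv : x != v by rewrite eq_sym.
have yv : y != v by rewrite eq_sym.
have zv : z != v by rewrite eq_sym.
have Mv a b c : v \in f -> a != v -> b != v -> c != v -> (f == [set a; b; c]) = false.
  by move=> fv *; apply: (neq_mem fv); apply: nv.
have Mu a b c : u \in f -> a != u -> b != u -> c != u -> (f == [set a; b; c]) = false.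
  by move=> fu *; apply: (neq_mem fu); apply: nu.
have Nv a b : v \notin f -> (f == [set v; a; b]) = false.
  by move=> fv; exact: neq_notin fv (iv a b).
have Nv' a b : v \notin f -> (f == [set a; v; b]) = false.
  by move=> fv; exact: neq_notin fv (iv' a b).
have Nu a b : u \notin f -> (f == [set u; a; b]) = false.
  by move=> fu; exact: neq_notin fu (iu a b).
(* Membership of [u] and [v] in [f] refutes most of the equations, and a Boolean identity remains in
   each of the four cases. *)
case: (boolP (u \in f)) => fu; case: (boolP (v \in f)) => fv.
- have -> : f \in F = false by apply/negP=> /uF; rewrite fu.
  rewrite (Mu v w x) // (Mu v x y) // (Mu v y z) // (Mu v w z) //.
  rewrite (Mv u w z) // (Mv u w x) // (Mv u x y) // (Mv u y z) //.
  by case: (f == [set u; v; w]); case: (f == [set u; v; y]); case: (f == [set u; v; z]).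
- have -> : f \in F = false by apply/negP=> /uF; rewrite fu.
  rewrite (Nv w x) // (Nv x y) // (Nv y z) // (Nv w z) // (Nv' u w) // (Nv' u y) // (Nv' u z) //.
  by case: (f == [set u; w; z]); case: (f == [set u; w; x]);
    case: (f == [set u; x; y]); case: (f == [set u; y; z]).
- rewrite (Nu w z) // (Nu w x) // (Nu x y) // (Nu y z) // (Nu v w) // (Nu v y) // (Nu v z) //.
  by case: (f \in F); case: (f == [set v; w; z]); case: (f == [set v; w; x]);
    case: (f == [set v; x; y]); case: (f == [set v; y; z]).
rewrite (Nu w z) // (Nu w x) // (Nu x y) // (Nu y z) // (Nu v w) // (Nu v y) // (Nu v z) //.
rewrite (Nv w x) // (Nv x y) // (Nv y z) // (Nv w z) //.
by rewrite !orbF.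
Qed.

(** An equivalence is required because a flip runs one subdivision forward and another one
    backward. *)
Definition subdiv_invariant (P : {set {set T}} -> Prop) :=
  forall F a b m, (forall f, f \in F -> #|f| = 3) ->
    (forall f, f \in F -> m \notin f) ->
    a != b -> a != m -> b != m -> P F <-> P (subdiv F a b m).

Lemma flip_invariant (P : {set {set T}} -> Prop) (G : {set {set T}}) a b c d n :
  subdiv_invariant P -> surf G -> (forall f, f \in G -> n \notin f) ->
  c != d -> c != n -> d != n -> tri G a b c -> tri G a b d ->
  (forall p, tri G c d p = false) -> P G ->
  [/\ surf (flip G a b c d), P (flip G a b c d)
    & forall f, f \in flip G a b c d -> n \notin f].
Proof.
move=> HP sG nG cd cn dn abc abd cdE PG.
have [ab bc ac] := tri_neq abc; have [_ bd ad] := tri_neq abd.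
have [an bn _] := tri_fresh_neq nG abc.
have abE p : tri G a b p -> p = c \/ p = d by exact: surf_two sG abc abd cd.
have fr := flip_fresh nG an bn cn dn; split=> //.
  exact: (surf_flip (surf_card sG) nG an bn cn dn cd abc abd abE cdE sG).
apply/(HP _ c d n); rewrite ?(flip_subdiv (surf_card sG) nG an bn cn dn cd abc abd abE cdE) //.
  exact: (flip_card (surf_card sG) cd abc abd).
exact/(HP _ a b n (surf_card sG)).
Qed.

Lemma subdiv_fresh (G : {set {set T}}) a b n k :
  (forall f, f \in G -> k \notin f) -> k != n ->
  forall f, f \in subdiv G a b n -> k \notin f.
Proof.
move=> kG kn f; rewrite inE; case: ifP => _ /andP[].
  by move=> _ /kG; apply: contra => kf; rewrite !inE kn kf !orbT.
by move/kG.
Qed.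

Lemma split_invariant (P : {set {set T}} -> Prop) :
  subdiv_invariant P -> P F ->
  surf (split_faces F v w x y z u) /\ P (split_faces F v w x y z u).
Proof.
move=> HP PF; rewrite -split_facesE.
have [vw wx vx] := tri_neq vwx; have [_ xy vy] := tri_neq vxy; have [_ yz vz] := tri_neq vyz.
have [vu wu xu] := tri_fresh_neq uF vwx; have [_ _ yu] := tri_fresh_neq uF vxy.
have [_ _ zu] := tri_fresh_neq uF vyz.
have [vm wm xm] := tri_fresh_neq mF vwx; have [_ _ ym] := tri_fresh_neq mF vxy.
have [_ _ zm] := tri_fresh_neq mF vyz.
have vxw : tri F v x w by rewrite tri23.
have sF1 : surf F1 by exact: surf_subdiv (surf_card sF) uF vx vu xu _ vxw sF.
have PF1 : P F1 by exact/(HP _ v x u (surf_card sF)).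
have mF1 : forall f, f \in F1 -> m \notin f.
  by apply: subdiv_fresh => //; rewrite eq_sym.
have vyu1 : tri F1 v y u.
  by have t := subdiv_tri_ma uF vx vu xu vxy; tri_perm t.
have uvw1 : tri F1 u v w by exact: subdiv_tri_ma uF vx vu xu _ vxw.
have vyz1 : tri F1 v y z.
  rewrite tri_subdiv_old // vyz /= eqxx /=.
  by rewrite ![x == _]eq_sym (negbTE vx) (eq_sym y) (negbTE xy) (eq_sym z) (negbTE xz).
(* The apices of [vx] in [F] are [w] and [y], so in [F1] the neighbors of [u] are [v], [w], [x],
   [y], and [z] is none of them. *)
have uzE p : tri F1 u z p = false.
  apply/negP => /(subdiv_tri_mP uF vx vu xu) [] [] [] e t.
  - by move: vz; rewrite e eqxx.
  - by move: xz; rewrite e eqxx.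
  - by case: (surf_two sF vxw vxy wy t) => e'; [move: wz|move: yz]; rewrite e' eqxx.
  - by case: (surf_two sF vxw vxy wy t) => e'; [move: wz|move: yz]; rewrite e' eqxx.
have uz : u != z by rewrite eq_sym.
have [sF2 PF2 mF2] := flip_invariant HP sF1 mF1 uz um zm vyu1 vyz1 uzE PF1.
have uvz2 : tri F2 u v z.
  have t : tri F2 u z v by rewrite (flip_tri_cd uz vyu1 vyz1 uzE) eqxx.
  by tri_perm t.
have uvw2 : tri F2 u v w.
  have [n1 n2 n3] := tri_neq uvw1.
  rewrite /tri n1 n2 n3 /= in_setU in_setD (tri_face uvw1) andbT; apply/orP; left.
  have wi : w \in [set u; v; w] by rewrite !inE eqxx orbT.
  rewrite in_set2 !(neq_mem wi) // !inE !negb_or -andbA.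
    by apply/and3P; split=> //; rewrite eq_sym.
  by apply/and3P; split=> //; rewrite eq_sym.
(* A face on [wz] in [F2] would be a face of [F], a face of [F1] at [u], or one of the two faces
   added by the first flip; the last two do not contain [w]. *)
have wzE2 p : tri F2 w z p = false.
  apply/negP => t; have [_ zp wp] := tri_neq t.
  have := tri_face t; rewrite in_setU in_setD => /orP[/andP[_ h]|].
    have t1 : tri F1 w z p by rewrite /tri wz zp wp h.
    have [e|pu] := eqVneq p u.
      rewrite {}e in t1; have t2 : tri F1 u w z by tri_perm t1.
      case: (subdiv_tri_mP uF vx vu xu t2) => -[[] e _].
      + by move: vw; rewrite e eqxx.
      + by move: wx; rewrite e eqxx.
      + by move: vz; rewrite e eqxx.
      + by move: xz; rewrite e eqxx.
    move: t1; rewrite tri_subdiv_old // => /andP[/tri_edge t1 _].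
    by move: wzE; rewrite t1.
  have wi : w \in [set w; z; p] by rewrite !inE eqxx.
  rewrite in_set2 !(neq_mem wi) // !inE !negb_or -andbA.
    by apply/and3P; split=> //; rewrite eq_sym.
  by apply/and3P; split=> //; rewrite eq_sym.
by have [sF3 PF3 _] := flip_invariant HP sF2 mF2 wz wm zm uvw2 uvz2 wzE2 PF2.
Qed.

End Split.
End Flips.

(** * Renaming labels and adding spare ones *)

Lemma imset_set3 (T T' : finType) (h : T -> T') x y z :
  h @: [set x; y; z] = [set h x; h y; h z].
Proof. by rewrite !imsetU !imset_set1. Qed.

Section Relabel.
Variables (m n : nat) (h : 'I_m -> 'I_n) (F : {set {set 'I_m}}).
Hypothesis h_inj : injective h.

Lemma tri_relabel x y z : tri (relabel h F) (h x) (h y) (h z) = tri F x y z.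
Proof.
rewrite /tri !(inj_eq h_inj) -imset_set3 /relabel.
by rewrite (mem_imset F _ (imset_inj h_inj)).
Qed.

Lemma relabel_card : (forall f, f \in F -> #|f| = 3) ->
  forall f, f \in relabel h F -> #|f| = 3.
Proof. by move=> F3 f /imsetP [g /F3 g3 ->]; rewrite card_imset. Qed.

Lemma relabel_triP x y z : tri (relabel h F) x y z ->
  exists x' y' z', [/\ x = h x', y = h y', z = h z' & tri F x' y' z'].
Proof.
move=> t; have := tri_face t => /imsetP [g gF e].
have /imsetP [x' _ ex] : x \in h @: g by rewrite -e !inE eqxx.
have /imsetP [y' _ ey] : y \in h @: g by rewrite -e !inE eqxx orbT.
have /imsetP [z' _ ez] : z \in h @: g by rewrite -e !inE eqxx orbT.
exists x', y', z'; split=> //.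
by rewrite -tri_relabel -ex -ey -ez.
Qed.

Lemma relabel_fresh u : u \notin codom h -> forall f, f \in relabel h F -> u \notin f.
Proof.
move=> uh f /imsetP [g _ ->]; apply: contra uh => /imsetP [i _ ->].
exact: codom_f.
Qed.

(** A partial inverse of [h]. The value [x0] off the image is arbitrary, because [inv] is applied
    only along paths whose edges come from faces in the image. *)
Let inv (x0 : 'I_m) p := odflt x0 [pick i | h i == p].

Lemma relabel_invK x0 i : inv x0 (h i) = i.
Proof.
by rewrite /inv; case: pickP => [j /eqP /h_inj //| /(_ i)]; rewrite eqxx.
Qed.

Lemma card_apices_relabel x y :
  #|[set z | tri (relabel h F) (h x) (h y) z]| = #|[set z | tri F x y z]|.
Proof.
rewrite -(card_imset _ h_inj); apply: eq_card => z; rewrite inE.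
apply/idP/imsetP => [t|[z']].
  have [x' [y' [z' [ex ey ez t']]]] := relabel_triP t.
  by exists z' => //; rewrite inE (h_inj ex) (h_inj ey).
by rewrite inE => t ->; rewrite tri_relabel.
Qed.

Lemma relabel_surf : surf F -> surf (relabel h F).
Proof.
move=> sF; split.
- exact: relabel_card (surf_card sF).
- move=> x y z /relabel_triP [x' [y' [z' [-> -> _ t]]]].
  by rewrite card_apices_relabel (surf_edge sF t).
- move=> v x x' y y' /relabel_triP [v0 [x0 [x1 [-> -> _ tx]]]].
  move=> /relabel_triP [v2 [y0 [y1 [/h_inj e -> _ ty]]]]; rewrite -{}e in ty.
  apply: (connect_map (h := h)) (surf_link sF tx ty) => p q t.
  by apply: connect1; rewrite tri_relabel.
- move=> x x' x'' y y' y'' /relabel_triP [x0 [x1 [x2 [-> _ _ tx]]]].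
  move=> /relabel_triP [y0 [y1 [y2 [-> _ _ ty]]]].
  apply: (connect_map (h := h)) (surf_conn sF tx ty) => p q /existsP [r t].
  by apply: connect1; apply/existsP; exists (h r); rewrite tri_relabel.
Qed.

Lemma unrelabel_surf : surf (relabel h F) -> surf F.
Proof.
move=> sF; split.
- move=> f fF; rewrite -(card_imset _ h_inj); apply: (surf_card sF).
  exact: imset_f.
- move=> x y z; rewrite -tri_relabel => t.
  by rewrite -card_apices_relabel (surf_edge sF t).
- move=> v x x' y y'; rewrite -!tri_relabel => tx ty.
  have := surf_link sF tx ty.
  rewrite -{2}(relabel_invK x x) -{2}(relabel_invK x y).
  apply: (connect_map (h := inv x)) => p q /relabel_triP [v' [p' [q' [ev -> -> t]]]].
  by apply: connect1; rewrite !relabel_invK (h_inj ev).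
- move=> x x' x'' y y' y''; rewrite -!tri_relabel => tx ty.
  have := surf_conn sF tx ty.
  rewrite -{2}(relabel_invK x x) -{2}(relabel_invK x y).
  apply: (connect_map (h := inv x)) => p q /existsP [r] /relabel_triP [p' [q' [r' [-> -> _ t]]]].
  by apply: connect1; rewrite !relabel_invK; apply/existsP; exists r'.
Qed.

Lemma edge_relabel x y : edge (relabel h F) (h x) (h y) = edge F x y.
Proof.
apply/existsP/existsP => [[z /relabel_triP]|[z t]].
  by move=> [x' [y' [z' [/h_inj -> /h_inj -> _ t]]]]; exists z'.
by exists (h z); rewrite tri_relabel.
Qed.

End Relabel.

Lemma relabel_comp m n k (h : 'I_m -> 'I_n) (g : 'I_n -> 'I_k) F :
  relabel g (relabel h F) = relabel (g \o h) F.
Proof.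
apply/setP=> f; apply/imsetP/imsetP => [[s /imsetP [r rF ->] ->]|[r rF ->]].
  by exists r => //; rewrite -imset_comp.
by exists (h @: r); [exact: imset_f | rewrite -imset_comp].
Qed.

Lemma relabel_setD3 m n (h : 'I_m -> 'I_n) F a b c : injective h ->
  relabel h (F :\: [set a; b; c]) = relabel h F :\: [set h @: a; h @: b; h @: c].
Proof.
move=> h_inj; apply/setP=> f; apply/imsetP/idP => [[g]|].
  rewrite !inE => /andP[ne gF] ->.
  by rewrite !(inj_eq (imset_inj h_inj)) ne (mem_imset F _ (imset_inj h_inj)).
rewrite !inE => /andP[ne /imsetP [g gF e]]; exists g => //.
by rewrite !inE gF andbT; move: ne; rewrite e !(inj_eq (imset_inj h_inj)).
Qed.

Lemma relabel_split m n (h : 'I_m -> 'I_n) F v w x y z u : injective h ->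
  relabel h (split_faces F v w x y z u) =
  split_faces (relabel h F) (h v) (h w) (h x) (h y) (h z) (h u).
Proof.
move=> h_inj; rewrite /split_faces -!(imset_set3 h) -relabel_setD3 //.
by rewrite /relabel !(imsetU, imset_set1).
Qed.

(** * Triangulations and balance in terms of ordered triples *)

Section Complexes.
Variable G : tricomplex.

Lemma adjE x y : (forall f, f \in faces G -> #|f| = 3) ->
  adj x y = edge (faces G) x y.
Proof.
move=> G3; apply/andP/existsP => [[xy /existsP [f /and3P[fG xf yf]]]|[z t]].
  by have [e [t _]] := third_vertex fG (G3 _ fG) xf yf xy; exists e.
have [xy _ _] := tri_neq t; split=> //; apply/existsP; exists [set x; y; z].
by rewrite (tri_face t) !inE !eqxx ?orbT.
Qed.

Lemma card_edge_faces x y : (forall f, f \in faces G -> #|f| = 3) -> x != y ->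
  #|[set f in faces G | (x \in f) && (y \in f)]| = #|[set z | tri (faces G) x y z]|.
Proof.
move=> G3 xy.
rewrite -(@card_in_imset _ _ (fun z => [set x; y; z]) [set z | tri (faces G) x y z]).
  apply: eq_card => f; rewrite inE; apply/and3P/imsetP => [[fG xf yf]|[z]].
    have [e [t ->]] := third_vertex fG (G3 _ fG) xf yf xy.
    by exists e => //; rewrite inE.
  by rewrite inE => t ->; rewrite (tri_face t) !inE !eqxx ?orbT.
move=> z z'; rewrite !inE => t t' e; have [_ yz xz] := tri_neq t.
have : z \in [set x; y; z'] by rewrite -e !inE eqxx orbT.
by rewrite !inE (eq_sym z) (negbTE xz) (eq_sym z) (negbTE yz) => /eqP.
Qed.

Lemma surface_triangulationP : surface_triangulation G <->
  [/\ surf (faces G), 0 < nv G & forall v, exists x y, tri (faces G) v x y].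
Proof.
split=> [[[n0 cov] G3 G2 Gl Gc]|[sG n0 cov]].
  have A x y : adj x y = edge (faces G) x y by exact: adjE.
  split=> //.
    split=> //.
    - move=> x y z t; have [xy _ _] := tri_neq t.
      by rewrite -card_edge_faces // G2 // A (tri_edge t).
    - move=> v x x' y y' tx ty.
      have := Gl v x y; rewrite !A => /(_ (tri_edge tx) (tri_edge ty)).
      apply: (connect_map (h := id)) => p q; rewrite /link_rel /= => f.
      exact/connect1/tri_of_face.
    - move=> x x' x'' y y' y'' _ _; have := Gc x y.
      by apply: (connect_map (h := id)) => p q; rewrite A; exact: connect1.
  move=> v; have [f fG vf] := cov v.
  have [x [y [z [t e]]]] := face_tri (G3 _ fG) fG.
  move: vf; rewrite e !inE => /orP[/orP[]|] /eqP ->; first by exists y, z.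
    by exists x, z; rewrite tri12.
  by exists x, y; tri_perm t.
have A x y : adj x y = edge (faces G) x y by exact: adjE (surf_card sG).
split.
- split=> // v; have [x [y t]] := cov v; exists [set v; x; y]; first exact: tri_face.
  by rewrite !inE eqxx.
- exact: surf_card sG.
- move=> x y; rewrite A => /existsP [z t]; have [xy _ _] := tri_neq t.
  by rewrite (card_edge_faces (surf_card sG) xy) (surf_edge sG t).
- move=> v x y; rewrite !A => /existsP [x' tx] /existsP [y' ty].
  apply: (connect_map (h := id)) (surf_link sG tx ty) => p q t.
  by apply: connect1; exact: tri_face t.
- move=> x y; have [x' [x'' tx]] := cov x; have [y' [y'' ty]] := cov y.
  apply: (connect_map (h := id)) (surf_conn sG tx ty) => p q t.
  by apply: connect1; rewrite A.
Qed.

Lemma balancedP : (forall f, f \in faces G -> #|f| = 3) ->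
  balanced G <-> exists c : 'I_(nv G) -> 'I_3,
    forall x y z, tri (faces G) x y z -> c x != c y.
Proof.
move=> G3; split=> -[c ok]; exists c.
  by move=> x y z t; apply/eqP/ok; rewrite adjE //; exact: tri_edge t.
by move=> x y; rewrite adjE // => /existsP [z /ok /eqP].
Qed.

End Complexes.

(** * Crossing curves and cohomology modulo 2 *)

Section Cohomology.
Variable T : finType.
Implicit Types (F : {set {set T}}) (f : {set T}) (x y z : T).

(** The three vertices may coincide, so vanishing on the diagonal and symmetry on edges are
    included. *)
Definition cocycle F (al : T -> T -> bool) :=
  forall f, f \in F -> forall i j k, i \in f -> j \in f -> k \in f ->
    al i j (+) al j k = al i k.

Definition H1_trivial F :=
  forall al, cocycle F al ->
    exists h : T -> bool, forall x y z, tri F x y z -> al x y = h x (+) h y.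

(* [phi x y] is the parity of the number of times that a path from [a] to [b] in
   the link of [i] runs through the edge [xy]. *)
Lemma link_coloring F i a b : surf F -> connect (tri F i) a b ->
  exists phi : T -> T -> bool, (forall x y, phi x y = phi y x) /\
    forall x y y', tri F i x y -> tri F i x y' -> y != y' ->
      phi x y (+) phi x y' = (x == a) (+) (x == b).
Proof.
move=> sF /connectP [p pth ->] {b}; elim: p a pth => [|a' p IH] a /=.
  by move=> _; exists (fun _ _ => false); split=> // *; rewrite !addbb.
case/andP=> t /IH {IH} [phi [sy phiE]].
(* The indicator of the first edge of the path; adding it changes the parity at [a] and [a']
   only. *)
pose E x y := (x == a) && (y == a') || (x == a') && (y == a).
exists (fun x y => phi x y (+) E x y); split=> [x y|x y y' ty ty' yy'].
  rewrite sy /E; congr addb.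
  by case: (x == a); case: (y == a); case: (x == a'); case: (y == a').
have [_ aa' _] := tri_neq t.
have key : E x y (+) E x y' = (x == a) (+) (x == a').
  rewrite /E; have [ex|xa] /= := eqVneq x a.
    rewrite ex in ty ty' *; rewrite (negbTE aa') /= !orbF.
    case: (surf_two sF ty ty' yy' t) => ->; rewrite eqxx.
      by rewrite eq_sym (negbTE yy').
    by rewrite (negbTE yy').
  have [ex|xa'] //= := eqVneq x a'; rewrite ex in ty ty' *.
  have t' : tri F i a' a by tri_perm t.
  case: (surf_two sF ty ty' yy' t') => ->; rewrite eqxx.
    by rewrite eq_sym (negbTE yy').
  by rewrite (negbTE yy').
move: (phiE _ _ _ ty ty' yy') key.
case: (phi x y); case: (phi x y'); case: (E x y); case: (E x y');
  by case: (x == a); case: (x == a'); case: (x == last a' p).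
Qed.

Section Curve.
Variables (F : {set {set T}}) (p q r : T).
Hypotheses (sF : surf F) (HF : H1_trivial F).
Hypotheses (pq : edge F p q) (qr : edge F q r) (pr : edge F p r).

(** The edges of the closed curve [pqr], which need not bound a face. *)
Definition on_curve x y :=
  [&& x \in [set p; q; r], y \in [set p; q; r] & x != y].

Lemma on_curve_sym x y : on_curve x y = on_curve y x.
Proof. by rewrite /on_curve andbCA eq_sym. Qed.

(** [Phi] colors the faces so that the color changes exactly across the curve, which means that the
    curve bounds modulo 2. Link colorings give such colorings [phi i] of the faces around each
    vertex [i]. On the faces at an edge [ij], [phi i] and [phi j] differ by a constant, and these
    constants form a cocycle. If it is the coboundary of [h], then adding [h i] to [phi i] makes the
    local colorings agree. *)
Lemma curve_coloring : exists Phi : T -> T -> T -> bool,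
  (forall x y z, tri F x y z -> Phi x y z = Phi y x z /\ Phi x y z = Phi x z y) /\
  (forall x y z z', tri F x y z -> tri F x y z' -> z != z' ->
     Phi x y z (+) Phi x y z' = on_curve x y).
Proof.
have [k1 t1] := existsP pq; have [k2 t2] := existsP qr; have [k3 t3] := existsP pr.
have [npq _ _] := tri_neq t1; have [nqr _ _] := tri_neq t2; have [npr _ _] := tri_neq t3.
(* At a vertex of the curve the link path joins its two neighbors on the curve; at any other vertex
   the constant coloring serves. *)
have loc i : exists phi : T -> T -> bool, (forall x y, phi x y = phi y x) /\
    forall x y y', tri F i x y -> tri F i x y' -> y != y' ->
      phi x y (+) phi x y' = on_curve i x.
  have [ei|ip] := eqVneq i p.
    have [phi [s E]] := link_coloring sF (surf_link sF t1 t3).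
    exists phi; split=> // x y y' ty ty' yy'; rewrite ei in ty ty' *.
    rewrite (E _ _ _ ty ty' yy') /on_curve !inE eqxx /=.
    have [->|xp] := eqVneq x p; first by rewrite (negbTE npq) (negbTE npr).
    by rewrite andbT /=; have [->|xq] := eqVneq x q; rewrite ?(negbTE nqr).
  have [ei|iq] := eqVneq i q.
    have t1' : tri F q p k1 by tri_perm t1.
    have [phi [s E]] := link_coloring sF (surf_link sF t1' t2).
    exists phi; split=> // x y y' ty ty' yy'; rewrite ei in ty ty' *.
    rewrite (E _ _ _ ty ty' yy') /on_curve !inE eqxx orbT /=.
    have [->|xp] := eqVneq x p; first by rewrite (negbTE npr) (eq_sym q p) npq.
    have [->|xq] := eqVneq x q; first by rewrite (negbTE nqr) andbF.
    by rewrite andbT.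
  have [ei|ir] := eqVneq i r.
    have t2' : tri F r q k2 by tri_perm t2. have t3' : tri F r p k3 by tri_perm t3.
    have [phi [s E]] := link_coloring sF (surf_link sF t3' t2').
    exists phi; split=> // x y y' ty ty' yy'; rewrite ei in ty ty' *.
    rewrite (E _ _ _ ty ty' yy') /on_curve !inE eqxx !orbT /=.
    have [->|xp] := eqVneq x p; first by rewrite (negbTE npq) (eq_sym r p) npr.
    have [->|xq] := eqVneq x q; first by rewrite (eq_sym r q) nqr.
    by rewrite /= eq_sym; case: (r == x).
  exists (fun _ _ => false); split=> // x y y' _ _ _.
  by rewrite /on_curve !inE (negbTE ip) (negbTE iq) (negbTE ir).
have [phi phiP] := fin_all_exists loc.
have sy i x y : phi i x y = phi i y x by have [] := phiP i.
have E i x y y' : tri F i x y -> tri F i x y' -> y != y' ->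
  phi i x y (+) phi i x y' = on_curve i x by have [_] := phiP i; exact.
(* Across [ij] both [phi i] and [phi j] jump exactly if [ij] lies on the curve, so their difference
   does not depend on the face chosen. Pairs that are no edge get the default [false]. *)
pose al i j := if [pick k | tri F i j k] is Some k then phi i j k (+) phi j i k else false.
have alE i j k : tri F i j k -> al i j = phi i j k (+) phi j i k.
  move=> t; rewrite /al; case: pickP => [k' t'|/(_ k)]; last by rewrite t.
  have [-> //|kk] := eqVneq k' k.
  have t2' : tri F j i k by rewrite tri12. have t3' : tri F j i k' by rewrite tri12.
  have := E _ _ _ _ t' t kk; have := E _ _ _ _ t3' t2' kk; rewrite on_curve_sym => <-.
  by case: (phi i j k); case: (phi i j k'); case: (phi j i k); case: (phi j i k').
have alxx i : al i i = false.
  by rewrite /al; case: pickP => // k; rewrite tri_xx.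
have alC i j k : tri F i j k -> al j i = al i j.
  move=> t; rewrite (alE _ _ _ t); rewrite tri12 in t; by rewrite (alE _ _ _ t) addbC.
have coc : cocycle F al.
  move=> f fF i j k fi fj fk.
  have [->|ij] := eqVneq i j; first by rewrite alxx.
  have [->|jk] := eqVneq j k; first by rewrite alxx addbF.
  have f3 := surf_card sF fF.
  have [<-|ik] := eqVneq i k.
    have [e [t _]] := third_vertex fF f3 fi fj ij.
    by rewrite (alC _ _ _ t) addbb alxx.
  have [t _] := tri_mem f3 fF ij jk ik fi fj fk.
  have t12 : tri F j k i by tri_perm t. have t23 : tri F i k j by tri_perm t.
  rewrite (alE _ _ _ t) (alE _ _ _ t12) (alE _ _ _ t23) (sy i k j) (sy j k i) (sy k j i).
  by case: (phi i j k); case: (phi j i k); case: (phi k i j).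
have [h hE] := HF coc.
exists (fun i j k => phi i j k (+) h i); split=> [x y z t|x y z z' t t' zz'].
  split; last by rewrite sy.
  have := hE _ _ _ t; rewrite (alE _ _ _ t).
  by case: (phi x y z); case: (phi y x z); case: (h x); case: (h y).
rewrite -(E _ _ _ _ t t' zz').
by case: (phi x y z); case: (phi x y z'); case: (h x).
Qed.

End Curve.

(** Color the faces with respect to the curve [v l0 l3]. From [v l1 l2] to [v l3 l4] the faces
    around [v] cross it once, at [v l3], so these two faces differ in color. The edge [l1 l4] makes
    them agree, since [l1] and [l4] are off the curve. *)
Lemma no_crossing F v l0 l1 l2 l3 l4 : surf F -> H1_trivial F ->
  tri F v l0 l1 -> tri F v l1 l2 -> tri F v l2 l3 -> tri F v l3 l4 ->
  l0 != l2 -> l1 != l3 -> l2 != l4 -> l0 != l3 -> l0 != l4 -> l1 != l4 ->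
  edge F l0 l3 -> edge F l1 l4 -> False.
Proof.
move=> sF HF t01 t12 t23 t34 n02 n13 n24 n03 n04 n14 e03 e14.
have [v0 n01 v1] := tri_neq t01; have [_ n12 v2] := tri_neq t12.
have [_ n23 v3] := tri_neq t23; have [_ n34 v4] := tri_neq t34.
have t32 : tri F v l3 l2 by tri_perm t23. have t21 : tri F v l2 l1 by tri_perm t12.
have t10 : tri F v l1 l0 by tri_perm t01.
have [Phi [S E]] := curve_coloring sF HF (tri_edge t01) e03 (tri_edge t34).
have S12 x y z : tri F x y z -> Phi x y z = Phi y x z by case/S.
have S23 x y z : tri F x y z -> Phi x y z = Phi x z y by case/S.
(* No edge at a vertex off the curve belongs to the curve, so all faces around the vertex have one
   color. *)
have off x : x \notin [set v; l0; l3] -> forall y y' z z',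
    tri F x y z -> tri F x y' z' -> Phi x y z = Phi x y' z'.
  move=> nx; have loc y z z' : tri F x y z -> tri F x y z' -> Phi x y z = Phi x y z'.
    have [-> //|zz] := eqVneq z z'; move=> t t'.
    have := E _ _ _ _ t t' zz; rewrite /on_curve (negbTE nx) /=.
    by case: (Phi x y z); case: (Phi x y z').
  move=> y y' z z' t t'; have /connectP [s ps e] := surf_link sF t t'.
  elim: s y z t ps e => [|w s IH] y z t /=; first by move=> _ e; rewrite e in t' *; exact: loc.
  case/andP=> tw ps e; rewrite (loc _ _ _ t tw) S23 //.
  by apply: IH => //; tri_perm tw.
have l1C : l1 \notin [set v; l0; l3].
  by rewrite !inE !negb_or (eq_sym l1 v) v1 (eq_sym l1 l0) n01 n13.
have l4C : l4 \notin [set v; l0; l3].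
  by rewrite !inE !negb_or !(eq_sym l4) v4 n04 n34.
have vl2 : on_curve v l0 l3 v l2 = false.
  by rewrite /on_curve !inE eqxx (eq_sym l2 v) (negbTE v2) (eq_sym l2) (negbTE n02) (negbTE n23).
have vl3 : on_curve v l0 l3 v l3 = true.
  by rewrite /on_curve !inE !eqxx ?orbT v3.
have a1 := E _ _ _ _ t21 t23 n13; rewrite vl2 in a1.
have a2 := E _ _ _ _ t32 t34 n24; rewrite vl3 in a2.
(* A face on [l1 l4] carries both the color around [l1] and the color around [l4]. *)
have [k tk] := existsP e14.
have tk' : tri F l4 l1 k by tri_perm tk.
have u1 : tri F l1 v l2 by tri_perm t12. have u4 : tri F l4 v l3 by tri_perm t34.
have b1 := off _ l1C _ _ _ _ u1 tk; have b4 := off _ l4C _ _ _ _ u4 tk'.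
have t43 : tri F v l4 l3 by tri_perm t34.
move: a1 a2 b1 b4.
rewrite -(S12 _ _ _ t12) -(S12 _ _ _ t43) (S23 _ _ _ t21) (S23 _ _ _ t23) (S23 _ _ _ t34).
rewrite (S12 _ _ _ tk) => a1 a2 <-.
move: a1 a2; case: (Phi v l1 l2); case: (Phi v l3 l2); case: (Phi v l4 l3) => //.
Qed.

End Cohomology.

(** * The octahedron *)

Lemma third_color (i j k l : 'I_3) :
  i != j -> i != k -> j != k -> i != l -> j != l -> l = k.
Proof.
by case: i => [[|[|[|i]]] ?] //; case: j => [[|[|[|j]]] ?] //;
  case: k => [[|[|[|k]]] ?] //; case: l => [[|[|[|l]]] ?] // *; apply/val_inj.
Qed.

Definition antipode_class (i : 'I_6) : 'I_3 := inord (i %/ 2).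

Lemma antipode_classE i k : (antipode_class i == k) = (i %/ 2 == k).
Proof.
rewrite -val_eqE /= inordK //.
by case: i => [[|[|[|[|[|[|i]]]]]] ?].
Qed.

Lemma oct_faceP (f : {set 'I_6}) : reflect
  (forall k, #|[set i in f | antipode_class i == k]| = 1)
  (f \in faces octahedral_sphere).
Proof.
have E k : #|[set i in f | antipode_class i == k]| = #|[set i in f | i %/ 2 == k]|.
  by apply: eq_card => i; rewrite !inE antipode_classE.
rewrite inE; apply: (iffP forallP) => H k; first by rewrite E; exact/eqP.
by rewrite -E; exact/eqP.
Qed.

(** The octahedron is the complex of all triangles of the complete tripartite graph on its antipodal
    pairs, so that adjacency and the 3-coloring determine each other. *)
Lemma tri_oct a b c : tri (faces octahedral_sphere) a b c =
  [&& antipode_class a != antipode_class b, antipode_class b != antipode_class c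
    & antipode_class a != antipode_class c].
Proof.
have key x y (f : {set 'I_6}) : f \in faces octahedral_sphere -> x \in f -> y \in f ->
    x != y -> antipode_class x != antipode_class y.
  move=> /oct_faceP fO xf yf; apply: contra => /eqP e.
  have /eqP/cards1P [p pE] := fO (antipode_class y).
  have: x \in [set p] by rewrite -pE inE xf e eqxx.
  have: y \in [set p] by rewrite -pE inE yf eqxx.
  by rewrite !inE => /eqP -> /eqP ->.
apply/idP/idP => [t|/and3P[ab bc ac]].
  have [ab bc ac] := tri_neq t; have fO := tri_face t.
  by apply/and3P; split; apply: (key _ _ _ fO) => //; rewrite !inE eqxx ?orbT.
have nab : a != b by apply: contraNneq ab => ->.
have nbc : b != c by apply: contraNneq bc => ->.
have nac : a != c by apply: contraNneq ac => ->.
rewrite /tri nab nbc nac /=; apply/oct_faceP => k; apply/eqP/cards1P.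
have [ea|ka] := eqVneq (antipode_class a) k.
  exists a; apply/setP=> i; rewrite !inE -ea.
  have [->|ia] := eqVneq i a; first by rewrite eqxx.
  have [->|ib] := eqVneq i b; first by rewrite [antipode_class b == _]eq_sym (negbTE ab) andbF.
  by have [->|ic] := eqVneq i c; first by rewrite [antipode_class c == _]eq_sym (negbTE ac) andbF.
have [eb|kb] := eqVneq (antipode_class b) k.
  exists b; apply/setP=> i; rewrite !inE -eb.
  have [->|ib] := eqVneq i b; first by rewrite eqxx orbT.
  have [->|ia] := eqVneq i a; first by rewrite (negbTE ab) andbF.
  by have [->|ic] := eqVneq i c; first by rewrite [antipode_class c == _]eq_sym (negbTE bc) andbF.
have ec := third_color ab ac bc ka kb; exists c; apply/setP=> i; rewrite !inE ec.
have [->|ic] := eqVneq i c; first by rewrite eqxx !orbT.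
have [->|ia] := eqVneq i a; first by rewrite (negbTE ac) andbF.
by have [->|ib] := eqVneq i b; first by rewrite (negbTE bc) andbF.
Qed.

Lemma oct_vertex (k : 'I_3) : exists i, antipode_class i = k.
Proof.
exists (inord k.*2); apply/eqP; rewrite antipode_classE.
by case: k => [[|[|[|k]]] ?] //=; rewrite inordK.
Qed.

Lemma card_class (k : 'I_3) : #|[set i | antipode_class i == k]| = 2.
Proof.
have -> : [set i | antipode_class i == k] = [set inord k.*2; inord k.*2.+1].
  apply/setP=> i; rewrite !inE antipode_classE -!val_eqE /=.
  case: k => [[|[|[|k]]] ?] //=; rewrite !inordK //.
  - by case: i => [[|[|[|[|[|[|i]]]]]] ?].
  - by case: i => [[|[|[|[|[|[|i]]]]]] ?].
  - by case: i => [[|[|[|[|[|[|i]]]]]] ?].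
by rewrite cards2 -val_eqE /=; case: k => [[|[|[|k]]] ?] //=; rewrite !inordK.
Qed.

Lemma oct_card f : f \in faces octahedral_sphere -> #|f| = 3.
Proof.
move/oct_faceP => fO.
have H k : exists x, [set i in f | antipode_class i == k] = [set x].
  by have /eqP/cards1P := fO k.
have [x xE] := fin_all_exists H.
have xk k : (x k \in f) && (antipode_class (x k) == k).
  by have : x k \in [set x k] by [rewrite inE]; rewrite -xE inE.
have x_inj : injective x.
  move=> j k e; have /andP[_ /eqP <-] := xk j.
  by rewrite e; have /andP[_ /eqP] := xk k.
have -> : f = x @: [set: 'I_3].
  apply/setP=> i; apply/idP/imsetP => [fi|[k _ ->]]; last by have /andP[] := xk k.
  exists (antipode_class i) => //.
  have : i \in [set i in f | antipode_class i == antipode_class i] by rewrite inE fi eqxx.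
  have : i \in [set j in f | antipode_class j == antipode_class i] by rewrite inE fi eqxx.
  by rewrite xE inE => /eqP.
by rewrite card_imset // cardsT card_ord.
Qed.

Lemma third_class (i j : 'I_3) : i != j -> exists k : 'I_3, i != k /\ j != k.
Proof.
case: i => [[|[|[|i]]] ?] //; case: j => [[|[|[|j]]] ?] // _;
  first [ by exists ord0 | by exists (inord 1); rewrite -!val_eqE /= inordK
        | by exists (inord 2); rewrite -!val_eqE /= inordK ].
Qed.

Lemma other_class (i : 'I_3) : exists k : 'I_3, i != k.
Proof.
by case: i => [[|i] ?]; [exists (inord 1)| exists ord0]; rewrite -val_eqE /= ?inordK.
Qed.

Lemma oct_triangulation : surface_triangulation octahedral_sphere.
Proof.
have cov a b : antipode_class a != antipode_class b ->
    exists c, tri (faces octahedral_sphere) a b c.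
  move=> ab; have [k [ak bk]] := third_class ab; have [c ck] := oct_vertex k.
  by exists c; rewrite tri_oct ab ck ak bk.
have dif a b c : tri (faces octahedral_sphere) a b c ->
  antipode_class a != antipode_class b by rewrite tri_oct => /and3P[].
apply/surface_triangulationP; split=> //; last first.
  move=> v; have [k vk] := other_class (antipode_class v).
  have [x xk] := oct_vertex k; exists x; apply: cov; by rewrite xk.
split.
- exact: oct_card.
- move=> x y z; rewrite tri_oct => /and3P[xy yz xz].
  rewrite -(card_class (antipode_class z)); apply: eq_card => w; rewrite !inE tri_oct xy /=.
  apply/andP/eqP => [[yw xw]|->]; last by split.
  exact: (third_color xy xz yz xw yw).
- move=> v x x' y y' /dif vx /dif vy.
  have [e|xy] := eqVneq (antipode_class x) (antipode_class y); last first.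
    by apply: connect1; rewrite tri_oct vx xy vy.
  have [w] := cov _ _ vx; rewrite tri_oct => /and3P[_ xw vw].
  apply: (@connect_trans _ _ w); apply: connect1; rewrite tri_oct ?vx ?vw ?vy ?xw //=.
  by rewrite -e eq_sym xw.
- move=> x _ _ y _ _ _ _.
  have E a b : antipode_class a != antipode_class b -> edge (faces octahedral_sphere) a b.
    by move/cov=> [c t]; exact: tri_edge t.
  have [e|xy] := eqVneq (antipode_class x) (antipode_class y); last exact/connect1/E.
  have [k xk] := other_class (antipode_class x); have [w wk] := oct_vertex k.
  by apply: (@connect_trans _ _ w); apply/connect1/E; rewrite wk // -e eq_sym.
Qed.

Lemma oct_balanced : balanced octahedral_sphere.
Proof.
apply/(balancedP oct_card); exists antipode_class => x y z.
by rewrite tri_oct => /and3P[].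
Qed.

Lemma isomorphic_sym G H : isomorphic G H -> isomorphic H G.
Proof.
case=> f [g fK gK] e; exists g; first by exists f.
rewrite -e relabel_comp /relabel.
have E : g \o f =1 id by move=> i /=.
by under eq_imset => s do rewrite (eq_imset _ E) imset_id; rewrite imset_id.
Qed.

Lemma isomorphic_trans G H K : isomorphic G H -> isomorphic H K -> isomorphic G K.
Proof.
case=> f fb e [g gb e']; exists (g \o f); first exact: bij_comp.
by rewrite -relabel_comp e.
Qed.

Lemma isomorphic_triangulation G H :
  isomorphic G H -> surface_triangulation H -> surface_triangulation G.
Proof.
case=> f fb e /surface_triangulationP [sH n0 cov].
have fi := bij_inj fb; apply/surface_triangulationP; split.
- by apply: (unrelabel_surf fi); rewrite e.
- by rewrite -(card_ord (nv G)) (bij_eq_card fb) card_ord.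
- move=> v; have [x [y]] := cov (f v); rewrite -e => /(relabel_triP fi).
  by move=> [v' [x' [y' [/fi -> _ _ t]]]]; exists x', y'.
Qed.

Lemma isomorphic_balanced G H :
  isomorphic G H -> surface_triangulation H -> balanced H -> balanced G.
Proof.
move=> iGH sH; have /surface_triangulationP[sG _ _] := isomorphic_triangulation iGH sH.
have /surface_triangulationP[sH' _ _] := sH.
case: iGH => f fb e /(balancedP (surf_card sH')) [c ok].
apply/(balancedP (surf_card sG)); exists (c \o f) => x y z t; apply: (ok _ _ (f z)).
by rewrite -e (tri_relabel _ (bij_inj fb)).
Qed.

(** In the octahedron differently colored vertices are adjacent. In a splitting [w] has the color of
    [y], hence [wz] is an edge already; in a contraction [v] has the color of [u], hence [vx] is an
    edge. *)
Lemma oct_immovable G H : isomorphic G octahedral_sphere -> P_move G H ->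
  isomorphic H octahedral_sphere.
Proof.
move=> iG [|[_ mv]]; first by move/isomorphic_sym/isomorphic_trans; apply.
have /surface_triangulationP[sG _ _] := isomorphic_triangulation iG oct_triangulation.
have G3 := surf_card sG.
case: iG => f fb e; pose k := antipode_class \o f.
have triE a b c : tri (faces G) a b c = [&& k a != k b, k b != k c & k a != k c].
  by rewrite -(tri_relabel _ (bij_inj fb)) e tri_oct.
have adjk a b : k a != k b -> adj a b.
  move=> ab; have [j [aj bj]] := third_class ab; have [c ck] := oct_vertex j.
  have [g _ gK] := fb; have kg : k (g c) = j by rewrite /k /= gK.
  by rewrite adjE //; apply: (@tri_edge _ _ _ _ (g c)); rewrite triE kg ab aj bj.
have D := tri_of_face G3.
case: mv => [[h [u [v [w [x [y [z]]]]]]]|[h [u [v [w [x [y [z]]]]]]]].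
  move=> [_ _ [/D + /D + /D +] /negP nwz _]; rewrite !triE.
  move=> /and3P[vw wx vx] /and3P[_ xy vy] /and3P[_ yz vz]; case: nwz; apply: adjk.
  have ->// : k w = k y by apply: (third_color vx vy xy); rewrite // eq_sym.
move=> [_ _ [/D + _ _ /D +] [/D + _ /negP nvx _] _]; rewrite !triE.
move=> /and3P[uw wx ux] /and3P[uz _ _] /and3P[vw wz vz]; case: nvx; apply: adjk.
by have -> : k v = k u by apply: (third_color wz _ _ _ _); rewrite // eq_sym.
Qed.

Lemma P_connected_oct G H : P_connected G H -> isomorphic G octahedral_sphere ->
  isomorphic H octahedral_sphere.
Proof.
elim=> {G H} [G H mv iG | // | G K H _ IH1 _ IH2 iG]; last exact/IH2/IH1.
exact: oct_immovable mv.
Qed.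

Lemma connect_closed (T : finType) (e : rel T) (P : pred T) x y :
  (forall p q, P p -> e p q -> P q) -> connect e x y -> P x -> P y.
Proof.
move=> cl /connectP [s + ->]; elim: s x => [|q s IH] p //= /andP[pq ps] Pp.
exact: IH ps (cl _ _ Pp pq).
Qed.

(** A 4-cycle in a link is closed under link adjacency, as each vertex has only two link neighbors;
    so it exhausts the connected link. *)
Lemma link_square (T : finType) (F : {set {set T}}) a w x y z b b' : surf F ->
  tri F a w x -> tri F a x y -> tri F a y z -> tri F a z w -> w != y -> x != z ->
  tri F a b b' -> b \in [:: w; x; y; z].
Proof.
move=> sF awx axy ayz azw wy xz ab.
have cl p q : p \in [:: w; x; y; z] -> tri F a p q -> q \in [:: w; x; y; z].
  have awz : tri F a w z by rewrite tri23.
  have axw : tri F a x w by rewrite tri23.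
  have ayx : tri F a y x by rewrite tri23.
  have azy : tri F a z y by rewrite tri23.
  have yw : y != w by rewrite eq_sym.
  rewrite !inE => /or4P[] /eqP ->.
  - by case/(surf_two sF awx awz xz) => ->; rewrite eqxx ?orbT.
  - by case/(surf_two sF axy axw yw) => ->; rewrite eqxx ?orbT.
  - by case/(surf_two sF ayx ayz xz) => ->; rewrite eqxx ?orbT.
  - by case/(surf_two sF azy azw yw) => ->; rewrite eqxx ?orbT.
by apply: (connect_closed cl (surf_link sF awx ab)); rewrite /= inE eqxx.
Qed.

Definition splittable (T : finType) (F : {set {set T}}) : Prop :=
  exists v w x y z, [/\ tri F v w x, tri F v x y, tri F v y z,
    [/\ w != y, w != z & x != z] & ~~ edge F w z].

(** Once links are 4-cycles, take [v], its link [w x y z] and the second apex [p] of [wx]. Closing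
    the links of [w], [x] and [z] yields the four faces at [p], and connectedness leaves no seventh
    vertex. *)
Lemma octahedron_of_unsplittable G : surface_triangulation G -> balanced G ->
  H1_trivial (faces G) -> ~ splittable (faces G) -> isomorphic G octahedral_sphere.
Proof.
move=> /surface_triangulationP[sG n0 cov] /(balancedP (surf_card sG)) [c cP] HG nsp.
set F := faces G in sG cov cP HG nsp *.
have c3 a b d : tri F a b d -> [/\ c a != c b, c b != c d & c a != c d].
  move=> t; split; first exact: cP t.
    by apply: (cP _ _ a); tri_perm t.
  by apply: (cP _ _ b); tri_perm t.
have alt v w x y : tri F v w x -> tri F v x y -> c y = c w.
  move=> /c3 [vw wx vx] /c3 [_ xy vy].
  by apply: (third_color vx vw _ vy xy); rewrite eq_sym.
(* If the path does not close up, the next link vertex [l] differs from [w]. The chords [wz] and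
   [xl] are edges as no splitting applies, which [no_crossing] excludes. *)
have square v w x y z : tri F v w x -> tri F v x y -> tri F v y z ->
    w != y -> x != z -> tri F v z w.
  move=> vwx vxy vyz wy xz.
  (* Colors alternate along the link, so vertices three apart have different colors. *)
  have far a b d e : tri F v a b -> tri F v b d -> tri F v d e -> a != e.
    move=> t1 t2 t3; have [_ ab _] := c3 _ _ _ t1.
    by apply: contraNneq ab => ->; rewrite (alt _ _ _ _ t2 t3).
  have ed a b d e : tri F v a b -> tri F v b d -> tri F v d e -> a != d -> b != e ->
      edge F a e.
    move=> t1 t2 t3 ad be; apply: contraT => ne; case: nsp.
    by exists v, a, b, d, e; split=> //; split=> //; exact: far t1 t2 t3.
  have vzy : tri F v z y by rewrite tri23.
  have [l [ly lE]] := surf_third sG vzy.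
  have vzl : tri F v z l by rewrite lE eqxx orbT.
  apply: contraT => nzw; have yl : y != l by rewrite eq_sym.
  case: (no_crossing sG HG vwx vxy vyz vzl wy xz yl).
  - exact: far vwx vxy vyz.
  - by apply: contraNneq nzw => ->.
  - exact: far vxy vyz vzl.
  - exact: ed vwx vxy vyz _ _.
  - exact: ed vxy vyz vzl _ _.
have [v] : exists v : 'I_(nv G), true by exists (Ordinal n0).
move=> _; have [w [x vwx]] := cov v.
have vxw : tri F v x w by rewrite tri23.
have [y [yw yE]] := surf_third sG vxw; have vxy : tri F v x y by rewrite yE eqxx orbT.
have vyx : tri F v y x by rewrite tri23.
have [z [zx zE]] := surf_third sG vyx; have vyz : tri F v y z by rewrite zE eqxx orbT.
have wy : w != y by rewrite eq_sym.
have xz : x != z by rewrite eq_sym.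
have vzw := square _ _ _ _ _ vwx vxy vyz wy xz.
have wxv : tri F w x v by tri_perm vwx.
have [p [pv pE]] := surf_third sG wxv; have wxp : tri F w x p by rewrite pE eqxx orbT.
have vp : v != p by rewrite eq_sym.
have wpz : tri F w p z.
  apply: (square w z v x p) => //; first by tri_perm vzw. by tri_perm vwx.
have xyp : tri F x y p.
  by apply: (square x p w v y) => //; [tri_perm wxp | tri_perm vwx | tri_perm vxy].
have zyp : tri F z y p.
  by apply: (square z p w v y) => //; [tri_perm wpz | tri_perm vzw | tri_perm vyz].
have pwx : tri F p w x by tri_perm wxp. have pxy : tri F p x y by tri_perm xyp.
have pyz : tri F p y z by tri_perm zyp. have pzw : tri F p z w by tri_perm wpz.
(* Antipodal vertices occupy positions [2k] and [2k+1], as in [octahedral_sphere]. *)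
pose s := [:: v; p; w; y; x; z].
have inS i : i \in s.
  (* Each of the six links is a 4-cycle inside [s]. *)
  have cl a b : a \in s -> edge F a b -> b \in s.
    have sub q r e u : tri F a q r -> tri F a r e -> tri F a e u -> tri F a u q ->
        q != e -> r != u -> {subset [:: q; r; e; u] <= s} -> edge F a b -> b \in s.
      move=> t1 t2 t3 t4 n1 n2 ss /existsP [d t].
      by apply/ss/(link_square sG t1 t2 t3 t4 n1 n2 t).
    have mem q r e u : q \in s -> r \in s -> e \in s -> u \in s ->
        {subset [:: q; r; e; u] <= s}.
      move=> qs rs es us i0 h.
      have: [|| i0 == q, i0 == r, i0 == e | i0 == u] by move: h; rewrite !inE.
      by case/or4P=> /eqP ->.
    have [vs ps ws] : [/\ v \in s, p \in s & w \in s] by rewrite !inE !eqxx ?orbT.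
    have [ys xs zs] : [/\ y \in s, x \in s & z \in s] by rewrite !inE !eqxx ?orbT.
    move=> h; have: [|| a == v, a == p, a == w, a == y, a == x | a == z].
      by move: h; rewrite !inE.
    case/or3P=> [/eqP e|/eqP e|/or4P[] /eqP e]; rewrite e in sub *.
    - by apply: (sub w x y z) => //; exact: mem.
    - by apply: (sub w x y z) => //; exact: mem.
    - by apply: (sub v x p z); first [done | exact: mem | tri_perm vwx | tri_perm vzw].
    - by apply: (sub v x p z); first [done | exact: mem | tri_perm vxy
        | tri_perm xyp | tri_perm zyp | tri_perm vyz].
    - by apply: (sub v w p y); first [done | exact: mem | tri_perm vwx
        | tri_perm wxp | tri_perm xyp | tri_perm vxy].
    - by apply: (sub v w p y); first [done | exact: mem | tri_perm vzw
        | tri_perm wpz | tri_perm zyp | tri_perm vyz].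
  have [i' [i'' ti]] := cov i.
  by apply: (connect_closed (P := mem s) cl (surf_conn sG vwx ti)); exact: mem_head.
have [vw wx vx] := c3 _ _ _ vwx; have cy := alt _ _ _ _ vwx vxy.
have cz := alt _ _ _ _ vxy vyz.
have cp : c p = c v by apply: (alt w v x p) => //; tri_perm vwx.
have us : uniq s.
  have ne a b : c a != c b -> a != b by apply: contraNneq => ->.
  by rewrite /= !inE !negb_or vp wy xz !ne ?cp ?cy ?cz // eq_sym.
pose f (i : 'I_(nv G)) : 'I_6 := inord (index i s).
pose g (k : 'I_6) := nth v s k.
have fK : cancel f g.
  by move=> i; rewrite /f /g inordK ?nth_index // -[6]/(size s) index_mem.
have gK : cancel g f.
  by move=> k; rewrite /f /g index_uniq ?inord_val //; case: k.
exists f; first by exists g.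
apply: eq_faces.
- exact: relabel_card (can_inj fK) (surf_card sG).
- exact: oct_card.
move=> a b d; rewrite -(gK a) -(gK b) -(gK d) (tri_relabel _ (can_inj fK)) !gK tri_oct.
apply/idP/idP => [/c3[ab bd ad]|].
  (* Antipodal vertices share a color, so the three vertices of a face lie in different pairs. *)
  have cg i j : antipode_class i = antipode_class j -> c (g i) = c (g j).
    move/eqP; rewrite antipode_classE inordK; last first.
      by case: (j) => [[|[|[|[|[|[|?]]]]]] ?].
    by rewrite /g; case: i => [[|[|[|[|[|[|i]]]]]] ?] //=;
      case: j => [[|[|[|[|[|[|j]]]]]] ?] //=; rewrite ?cp ?cy ?cz.
  by apply/and3P; split; [move: ab|move: bd|move: ad]; apply: contraNneq => /cg ->.
have K i j : (antipode_class i == antipode_class j) = (i %/ 2 == j %/ 2).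
  rewrite antipode_classE inordK //; by case: (j) => [[|[|[|[|[|[|?]]]]]] ?].
(* Conversely, each of the eight facets is one of the faces found above. *)
rewrite !K /g; case: a => [[|[|[|[|[|[|a]]]]]] ?] //=;
  case: b => [[|[|[|[|[|[|b]]]]]] ?] //=; case: d => [[|[|[|[|[|[|d]]]]]] ?] //= _;
  first [tri_perm vwx|tri_perm vxy|tri_perm vyz|tri_perm vzw
        |tri_perm pwx|tri_perm pxy|tri_perm pyz|tri_perm pzw].
Qed.

(** * Iterated P-splittings *)

Section SplitFaces.
Variables (T : finType) (F : {set {set T}}) (v w x y z u : T).
Hypothesis (sF : surf F).
Hypothesis (uF : forall f, f \in F -> u \notin f).
Hypotheses (vwx : tri F v w x) (vxy : tri F v x y) (vyz : tri F v y z).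
Hypotheses (wy : w != y) (wz : w != z) (xz : x != z).
Let S := split_faces F v w x y z u.

Lemma split_neq : [/\ [/\ v != w, v != x, v != y & v != z], [/\ w != x, x != y & y != z]
  & [/\ v != u, w != u, x != u, y != u & z != u]].
Proof.
have [vw wx vx] := tri_neq vwx; have [_ xy vy] := tri_neq vxy; have [_ yz vz] := tri_neq vyz.
have [vu wu xu] := tri_fresh_neq uF vwx; have [_ _ yu] := tri_fresh_neq uF vxy.
by have [_ _ zu] := tri_fresh_neq uF vyz.
Qed.

Lemma split_new : [/\ tri S v w z, tri S u w z, tri S u w x, tri S u x y & tri S u y z].
Proof.
have [[vw vx vy vz] [wx xy yz] [vu wu xu yu zu]] := split_neq.
by split; rewrite /tri ?(eq_sym u) ?vw ?wz ?vz ?wu ?zu ?wx ?xu ?xy ?yu ?yz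
  /S /split_faces in_setU !in_setU !in_set1 !eqxx ?orbT.
Qed.

Lemma split_triP a b d : tri S a b d ->
  tri F a b d /\
    [set a; b; d] \notin [set [set v; w; x]; [set v; x; y]; [set v; y; z]] \/
  [set a; b; d] \in [set [set v; w; z]; [set u; w; z]; [set u; w; x];
                         [set u; x; y]; [set u; y; z]].
Proof.
move=> t; have [ab bd ad] := tri_neq t; have := tri_face t.
rewrite /S /split_faces in_setU in_setD => /orP[/andP[nr fF]|]; [left|by right].
by rewrite /tri ab bd ad fF.
Qed.

(** Needed for the covering clause: the deleted faces must not leave a vertex without a face. *)
Lemma split_used a b d : tri F a b d -> exists b' d', tri S a b' d'.
Proof.
move=> t; have [t1 t2 t3 t4 t5] := split_new.
case: (boolP ([set a; b; d] \in [set [set v; w; x]; [set v; x; y]; [set v; y; z]])) => h.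
  have: a \in [:: v; w; x; y; z].
    have : a \in [set a; b; d] by rewrite !inE eqxx.
    rewrite !in_setU !in_set1 in h; case/orP: h => [/orP[]|] /eqP ->; rewrite !inE;
      by case/orP=> [/orP[]|] -> ; rewrite ?orbT.
  rewrite !inE => /or3P[/eqP ->|/eqP ->|/or3P[] /eqP ->].
  - by exists w, z.
  - by exists v, z; tri_perm t1.
  - by exists u, y; tri_perm t4.
  - by exists u, z; tri_perm t5.
  - by exists v, w; tri_perm t1.
exists b, d; have [ab bd ad] := tri_neq t.
by rewrite /tri ab bd ad in_setU in_setD h (tri_face t).
Qed.

(** The colors of [v] and [y] leave only one for [x] and [z], so [z] is colored as [x], and [u] as
    [v]; hence the new faces carry three colors. *)
Lemma split_coloring (c : T -> 'I_3) : c u = c v ->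
  (forall a b d, tri F a b d -> c a != c b) ->
  forall a b d, tri S a b d -> c a != c b.
Proof.
move=> cu cF a b d t; have [ab _ _] := tri_neq t.
have c3 p q r : tri F p q r -> [/\ c p != c q, c q != c r & c p != c r].
  move=> s; split; first exact: cF s.
    by apply: (cF _ _ p); tri_perm s.
  by apply: (cF _ _ q); tri_perm s.
have [vw wx vx] := c3 _ _ _ vwx; have [_ xy vy] := c3 _ _ _ vxy.
have [_ yz vz] := c3 _ _ _ vyz.
have cz : c z = c x by apply: (third_color vy vx _ vz yz); rewrite eq_sym.
case: (split_triP t) => [[] /cF //|].
have key p q r : [set a; b; d] = [set p; q; r] -> c p != c q -> c q != c r -> c p != c r ->
    c a != c b.
  move=> e pq qr pr.
  have : a \in [set p; q; r] by rewrite -e !inE eqxx.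
  have : b \in [set p; q; r] by rewrite -e !inE eqxx orbT.
  by rewrite !inE => /orP[/orP[]|] /eqP eb /orP[/orP[]|] /eqP ea;
    move: ab; rewrite ea eb ?eqxx // => _; rewrite // eq_sym.
rewrite !in_setU !in_set1 -!orbA => /or4P[||| /orP[]] /eqP /key; apply;
  rewrite ?cu ?cz //.
by rewrite -cz.
Qed.

(** The only faces on [vx] were [vwx] and [vxy], both deleted, and no new face contains both [v] and
    [x]. *)
Lemma split_splittable : splittable S.
Proof.
have [[vw vx vy vz] [wx xy yz] [vu wu xu yu zu]] := split_neq.
have [t1 t2 t3 t4 t5] := split_new.
exists w, v, z, u, x; split; [by tri_perm t1|by tri_perm t2|by tri_perm t3| |].
  by split=> //; rewrite eq_sym.
apply/negP => /existsP [k t]; have vxw : tri F v x w by rewrite tri23.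
case: (split_triP t) => [[tF]|].
  case: (surf_two sF vxw vxy wy tF) => ->; rewrite !in_setU !in_set1.
    by rewrite set3AC eqxx.
  by rewrite eqxx orbT.
have vi : v \in [set v; x; k] by rewrite !inE eqxx.
have xi : x \in [set v; x; k] by rewrite !inE eqxx orbT.
rewrite !in_setU !in_set1 (neq_mem xi) ?(neq_mem vi) //= !inE !negb_or -andbA;
  by apply/and3P; split=> //; rewrite eq_sym.
Qed.

End SplitFaces.

Definition relabel_invariant (P : forall n, {set {set 'I_n}} -> Prop) :=
  forall m n (h : 'I_m -> 'I_n) F, injective h -> P m F <-> P n (relabel h F).

Lemma codom_lift_max n (j : 'I_n.+1) : (j \in codom (lift ord_max)) = (j != ord_max).
Proof.
apply/codomP/idP => [[i ->]|]; first by rewrite eq_sym neq_lift.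
by rewrite eq_sym => /unlift_some [i -> _]; exists i.
Qed.

Section Step.
Variable P : forall n, {set {set 'I_n}} -> Prop.
Hypothesis P_relabel : relabel_invariant P.
Hypothesis P_subdiv : forall n, subdiv_invariant (P (n := n)).

Lemma split_step G : surface_triangulation G -> balanced G -> splittable (faces G) ->
  P (faces G) -> exists H, [/\ surface_triangulation H, balanced H & splittable (faces H)] /\
    [/\ P (faces H), nv H = (nv G).+1 & P_move G H].
Proof.
move=> /surface_triangulationP[sG n0 cov] bG [v [w [x [y [z [vwx vxy vyz [wy wz xz] nwz]]]]]] PG.
have G3 := surf_card sG.
(* [e1] makes room for the new vertex [u], and [e2] for the midpoint used by the flips. The moves
   take place with both labels present; the result is then pulled back along [e2], which drops the
   midpoint. *)
pose e1 : 'I_(nv G) -> 'I_(nv G).+1 := lift ord_max.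
pose e2 : 'I_(nv G).+1 -> 'I_(nv G).+2 := lift ord_max.
have i1 : injective e1 by exact: lift_inj.
have i2 : injective e2 by exact: lift_inj.
pose u : 'I_(nv G).+1 := ord_max.
pose F1 := relabel e1 (faces G); pose F2 := relabel e2 F1.
have s1 : surf F1 by exact: relabel_surf.
have s2 : surf F2 by exact: relabel_surf.
have f1 : forall f, f \in F1 -> u \notin f.
  by apply: relabel_fresh; rewrite codom_lift_max eqxx.
have f2 : forall f, f \in F2 -> e2 u \notin f.
  by move=> f /imsetP [g /f1 ug ->]; rewrite (mem_imset _ _ i2).
have f2' : forall f, f \in F2 -> ord_max \notin f.
  by apply: relabel_fresh; rewrite codom_lift_max eqxx.
have um : e2 u != ord_max by rewrite eq_sym neq_lift.
have T1 a b c : tri (faces G) a b c -> tri F1 (e1 a) (e1 b) (e1 c) by rewrite tri_relabel.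
have T2 a b c : tri F1 a b c -> tri F2 (e2 a) (e2 b) (e2 c) by rewrite tri_relabel.
have n1 a b : a != b -> e1 a != e1 b by rewrite (inj_eq i1).
have n2 a b : a != b -> e2 a != e2 b by rewrite (inj_eq i2).
pose S := split_faces F1 (e1 v) (e1 w) (e1 x) (e1 y) (e1 z) u.
have nwz2 : ~~ edge F2 (e2 (e1 w)) (e2 (e1 z)) by rewrite !edge_relabel.
have P2 : P F2 by apply/(P_relabel _ i2)/(P_relabel _ i1).
have [] := split_invariant s2 f2 f2' um (T2 _ _ _ (T1 _ _ _ vwx)) (T2 _ _ _ (T1 _ _ _ vxy))
  (T2 _ _ _ (T1 _ _ _ vyz)) (n2 _ _ (n1 _ _ wy)) (n2 _ _ (n1 _ _ wz)) (n2 _ _ (n1 _ _ xz))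
  nwz2 (@P_subdiv _) P2.
rewrite -relabel_split // -/S => /(unrelabel_surf i2) sS /(P_relabel _ i2) PS.
exists (Tricomplex S).
have news := split_new f1 (T1 _ _ _ vwx) (T1 _ _ _ vxy) (T1 _ _ _ vyz) (n1 _ _ wz).
have stH : surface_triangulation (Tricomplex S).
  apply/surface_triangulationP; split=> // i.
  have [->|iu] := eqVneq i u; first by case: news => _ t _ _ _; exists (e1 w), (e1 z).
  have /codomP [j ->] : i \in codom e1 by rewrite codom_lift_max.
  have [a [b t]] := cov j.
  exact: (split_used f1 (T1 _ _ _ vwx) (T1 _ _ _ vxy) (T1 _ _ _ vyz) (n1 _ _ wz) (T1 _ _ _ t)).
split; split=> //.
- have [c cP] := (balancedP G3).1 bG; apply/(@balancedP (Tricomplex S) (surf_card sS)).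
  pose c' (j : 'I_(nv G).+1) := if unlift ord_max j is Some i then c i else c v.
  have c'E i : c' (e1 i) = c i by rewrite /c' /e1 liftK.
  exists c'; apply: (split_coloring (T1 _ _ _ vwx) (T1 _ _ _ vxy) (T1 _ _ _ vyz)).
    by rewrite c'E /c' unlift_none.
  move=> a b d /(relabel_triP i1) [a' [b' [d' [-> -> _ t]]]].
  by rewrite !c'E; exact: cP t.
- exact: (split_splittable s1 f1 (T1 _ _ _ vwx) (T1 _ _ _ vxy) (T1 _ _ _ vyz)
    (n1 _ _ wy) (n1 _ _ wz) (n1 _ _ xz)).
right; split=> //; left; exists e1, u, v, w, x, y, z; split.
- by split=> // j; rewrite codom_lift_max.
- have [_ wx _] := tri_neq vwx; have [_ xy _] := tri_neq vxy; have [_ yz _] := tri_neq vyz.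
  by rewrite /= !inE !negb_or wx wy wz xy xz yz.
- by split; exact: tri_face.
- by rewrite adjE.
by rewrite relabel_setD3 // !imset_set3.
Qed.

Lemma unbounded_splittings G N : surface_triangulation G -> balanced G ->
  splittable (faces G) -> P (faces G) ->
  exists H, [/\ surface_triangulation H, balanced H & P (faces H)] /\
    (N <= nv H)%N /\ P_connected G H.
Proof.
move=> sG bG spG PG.
(* The induction has to carry the splittability of the last triangulation along. *)
suff: exists H, [/\ surface_triangulation H, balanced H & splittable (faces H)] /\
    [/\ P (faces H), (N <= nv H)%N & P_connected G H].
  by move=> [H [[sH bH _] [PH nH cH]]]; exists H.
elim: N => [|N [H [[sH bH spH] [PH nH cH]]]].
  by exists G; do 2!split=> //; exact: rt_refl.
have [K [[sK bK spK] [PK nK mv]]] := split_step sH bH spH PH.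
exists K; do 2!split=> //; first by rewrite nK.
exact: rt_trans cH (rt_step _ _ _ _ mv).
Qed.

End Step.

(** * Subdividing an edge twice *)

Lemma subdiv_used (T : finType) (F : {set {set T}}) a b m x x' x'' :
  (forall f, f \in F -> m \notin f) -> a != b -> a != m -> b != m ->
  tri F x x' x'' -> exists y y', tri (subdiv F a b m) x y y'.
Proof.
move=> mF ab am bm t.
case: (subdiv_link_fwd mF ab am bm t) => [t'|[_ _ t' _]]; do 2!eexists; exact: t'.
Qed.

(** The edge [ab] becomes the path [a], [m], [m'], [b], colored alternately, while the apices of
    [ab], to which both new vertices are joined, have the third color. After a single subdivision
    the midpoint would be adjacent to all three colors. *)
Lemma double_subdivision_coloring (T : finType) (F : {set {set T}}) a b m m' (c : T -> 'I_3) :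
  (forall f, f \in F -> m \notin f) -> (forall f, f \in F -> m' \notin f) ->
  a != b -> a != m -> b != m -> a != m' -> b != m' -> m != m' ->
  c m = c b -> c m' = c a ->
  (forall x y z, tri F x y z -> c x != c y) ->
  forall x y z, tri (subdiv (subdiv F a b m) m b m') x y z -> c x != c y.
Proof.
move=> mF mF' ab am bm am' bm' mm' cm cm' cF.
pose D x y z := [/\ c x != c y, c y != c z & c x != c z].
have D12 x y z : D x y z -> D y x z by case=> ? ? ?; split=> //; rewrite eq_sym.
have D23 x y z : D x y z -> D x z y by case=> ? ? ?; split=> //; rewrite eq_sym.
have DR x y z : D z x y -> D x y z by move/D12/D23.
have DF x y z : tri F x y z -> D x y z.
  move=> t; split; first exact: cF t.
    by apply: (cF _ _ x); tri_perm t.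
  by apply: (cF _ _ y); tri_perm t.
have abD z : tri F a b z -> D m a z by rewrite /D cm => /DF [? ? ?]; split=> //; rewrite eq_sym.
set F1 := subdiv F a b m.
have mF1 : forall f, f \in F1 -> m' \notin f by apply: subdiv_fresh => //; rewrite eq_sym.
have mb : m != b by rewrite eq_sym.
have F1m y z : tri F1 m y z -> y != b -> z != b -> D m y z.
  move=> /(subdiv_tri_mP mF ab am bm) [] [[] -> t] yb zb; rewrite ?eqxx // in yb zb *.
    exact: abD.
  exact/D23/abD.
have F1b y : tri F1 m b y -> tri F a b y.
  move=> /(subdiv_tri_mP mF ab am bm) [] [[] e t] //.
  - by rewrite tri_xyy in t.
  - by rewrite tri_xyy in t.
(* After the first subdivision only the faces on [mb] are badly colored, and these are the ones that
   the second subdivision removes. *)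
have F1D x y z : tri F1 x y z -> ~~ ((m \in [:: x; y; z]) && (b \in [:: x; y; z])) -> D x y z.
  move=> t nmb; have [e|xm] := eqVneq x m.
    move: nmb; rewrite e !inE eqxx /= !negb_or !(eq_sym b) => /and3P[_ yb zb].
    by rewrite e in t; exact: F1m t yb zb.
  have [e|ym] := eqVneq y m.
    move: nmb; rewrite e !inE eqxx orbT /= !negb_or !(eq_sym b) => /and3P[xb _ zb].
    by rewrite e in t; apply/D12/F1m; rewrite // tri12.
  have [e|zm] := eqVneq z m.
    move: nmb; rewrite e !inE eqxx !orbT /= !negb_or !(eq_sym b) => /and3P[xb yb _].
    by rewrite e in t; apply/DR/F1m; rewrite // -triR.
  by move: t; rewrite tri_subdiv_old // => /andP[/DF].
have F2m y z : tri (subdiv F1 m b m') m' y z -> D m' y z.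
  have k q r : q = m \/ q = b -> tri F1 m b r -> D m' q r.
    move=> e /F1b /DF [ab' br ar]; rewrite /D cm'.
    by have -> : c q = c b by case: e => ->.
  move=> /(subdiv_tri_mP mF1 mb mm' bm') [] [e t]; first exact: k.
  exact/D23/k.
move=> x y z t; suff [] : D x y z by [].
have [e|xm] := eqVneq x m'; first by rewrite e in t *; exact: F2m.
have [e|ym] := eqVneq y m'; first by rewrite e in t *; apply/D12/F2m; rewrite tri12.
have [e|zm] := eqVneq z m'; first by rewrite e in t *; apply/DR/F2m; rewrite -triR.
move: t; rewrite tri_subdiv_old // => /andP[t nb].
by apply: F1D t _; rewrite !inE.
Qed.

Section DoubleSubdivision.
Variable P : forall n, {set {set 'I_n}} -> Prop.
Hypothesis P_relabel : relabel_invariant P.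
Hypothesis P_subdiv : forall n, subdiv_invariant (P (n := n)).

Lemma double_subdivision G : surface_triangulation G -> balanced G -> P (faces G) ->
  exists H, [/\ surface_triangulation H, balanced H, P (faces H) & nv H = (nv G).+2].
Proof.
move=> /surface_triangulationP[sG n0 cov] bG PG; have G3 := surf_card sG.
pose e1 : 'I_(nv G) -> 'I_(nv G).+1 := lift ord_max.
pose e2 : 'I_(nv G).+1 -> 'I_(nv G).+2 := lift ord_max.
have i1 : injective e1 by exact: lift_inj.
have i2 : injective e2 by exact: lift_inj.
pose e := e2 \o e1; have ie : injective e by exact: inj_comp.
pose F := relabel e (faces G).
pose m := e2 ord_max; pose m' : 'I_(nv G).+2 := ord_max.
have sF : surf F by exact: relabel_surf.
have PF : P F by apply/(P_relabel _ ie).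
have mF : forall f, f \in F -> m \notin f.
  apply: relabel_fresh; apply/codomP => -[j /i2 /eqP]; apply/negP.
  by rewrite neq_lift.
have mF' : forall f, f \in F -> m' \notin f.
  by apply: relabel_fresh; apply/codomP => -[j /eqP]; apply/negP; rewrite neq_lift.
have mm' : m != m' by rewrite eq_sym neq_lift.
have [a' [b' t']] := cov (Ordinal n0); set v := Ordinal n0 in t'.
pose a := e v; pose b := e a'; pose d := e b'.
have t : tri F a b d by rewrite tri_relabel.
have [ab _ _] := tri_neq t.
have [am bm _] := tri_fresh_neq mF t; have [am' bm' _] := tri_fresh_neq mF' t.
have mb : m != b by rewrite eq_sym.
pose F1 := subdiv F a b m; pose F2 := subdiv F1 m b m'.
have s1 : surf F1 by exact: surf_subdiv (surf_card sF) mF ab am bm _ t sF.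
have P1 : P F1 by apply/(P_subdiv (surf_card sF) mF ab am bm).
have mF1 : forall f, f \in F1 -> m' \notin f by apply: subdiv_fresh => //; rewrite eq_sym.
have t1 : tri F1 m b d by exact: subdiv_tri_mb.
have s2 : surf F2 by exact: surf_subdiv (surf_card s1) mF1 mb mm' bm' _ t1 s1.
have P2 : P F2 by apply/(P_subdiv (surf_card s1) mF1 mb mm' bm').
exists (Tricomplex F2); split=> //.
  apply/surface_triangulationP; split=> // i.
  have [->|im'] := eqVneq i m'.
    by exists b, d; exact: subdiv_tri_mb.
  have [j ej] : exists j, i = e2 j by apply/codomP; rewrite codom_lift_max.
  suff [y [y' ty]] : exists y y', tri F1 i y y' by apply: subdiv_used ty.
  have [jm|jm] := eqVneq j ord_max; first by exists b, d; rewrite ej jm.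
  have [k ek] : exists k, j = e1 k by apply/codomP; rewrite codom_lift_max.
  have [y [y' ty]] := cov k.
  have ty' : tri F i (e y) (e y') by rewrite ej ek -/(e k) tri_relabel.
  by apply: subdiv_used ty'.
have [c cP] := (balancedP G3).1 bG; apply/(@balancedP (Tricomplex F2) (surf_card s2)).
pose c' (i : 'I_(nv G).+2) := if unlift ord_max i is Some j then
   (if unlift ord_max j is Some k then c k else c a') else c v.
have c'E k : c' (e k) = c k by rewrite /c' /e /= /e2 /e1 !liftK.
exists c'; apply: (double_subdivision_coloring mF mF') => //.
- by rewrite c'E /c' /m /e2 liftK unlift_none.
- by rewrite c'E /c' unlift_none.
move=> x y z /(relabel_triP ie) [x' [y' [z' [-> -> _ s]]]].
by rewrite !c'E; exact: cP s.
Qed.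

End DoubleSubdivision.

From mathcomp Require Import all_classical all_reals topology normedtype realfun.
From mathcomp Require Import ring lra.
Import Order.TTheory GRing.Theory Num.Theory.
Import numFieldNormedType.Exports.

(** * Homeomorphisms between realizations *)

Local Open Scope ring_scope.
Local Open Scope classical_set_scope.

Lemma within_continuous_comp (X Y Z : topologicalType) (A : set X) (B : set Y)
    (f : X -> Y) (g : Y -> Z) :
  {within A, continuous f} -> {within B, continuous g} ->
  (forall a, A a -> B (f a)) -> {within A, continuous (g \o f)}.
Proof.
move=> /subspace_continuousP cf /subspace_continuousP cg AB.
apply/subspace_continuousP => x Ax.
apply: (@cvg_trans _ (g @ within B (nbhs (f x)))); last exact: cg (AB _ Ax).
move=> U gU; have := cf _ Ax _ gU; rewrite /nbhs /= /within /= => H.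
by apply: (@filterS _ (nbhs x)) H => z H Az; exact: H Az (AB _ Az).
Qed.

Lemma homeomorphic_sym (X Y : topologicalType) (A : set X) (B : set Y) :
  homeomorphic A B -> homeomorphic B A.
Proof. by case=> f [g [[cf cg] AB BA fK gK]]; exists g, f. Qed.

Lemma homeomorphic_trans (X Y Z : topologicalType) (A : set X) (B : set Y) (C : set Z) :
  homeomorphic A B -> homeomorphic B C -> homeomorphic A C.
Proof.
case=> f [g [[cf cg] AB BA fK gK]] [f' [g' [[cf' cg'] BC CB fK' gK']]].
exists (f' \o f), (g \o g'); split=> [|a Aa|c Cc|a Aa|c Cc] /=.
- by split; [exact: within_continuous_comp AB | exact: within_continuous_comp CB].
- exact/BC/AB.
- exact/BA/CB.
- by rewrite fK' ?fK //; exact: AB.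
- by rewrite gK ?gK' //; exact: CB.
Qed.

Section Rows.
Variable R : realType.

Lemma cvg_row (X : Type) (F : set_system X) {FF : Filter F} n (f : X -> 'rV[R]_n) (l : 'rV[R]_n) :
  (forall j, f x 0 j @[x --> F] --> l 0 j) -> f @ F --> l.
Proof.
move=> H A [P MP sPA]; rewrite /nbhs /=.
have : \forall x \near F, forall j, P 0 j (f x 0 j).
  by apply: filter_forall => j; exact: H (MP 0 j).
by apply: filterS => x Px; apply: sPA => i j; rewrite ord1.
Qed.

Lemma continuous_row (X : topologicalType) n (f : X -> 'rV[R]_n) :
  (forall j, continuous (fun x => f x 0 j)) -> continuous f.
Proof. by move=> H x; apply: cvg_row => j; exact: H. Qed.

Lemma coord_row n (i : 'I_n) : continuous (fun t : 'rV[R]_n => t 0 i).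
Proof. exact: coord_continuous. Qed.

Lemma continuous_sumr (X : topologicalType) (I : Type) (r : seq I) (P : pred I)
    (f : I -> X -> R) : (forall i, continuous (f i)) ->
  continuous (fun x => \sum_(i <- r | P i) f i x).
Proof.
move=> H; elim: r => [|i r IH].
  rewrite (_ : (fun _ => _) = fun=> 0); first exact: cst_continuous.
  by apply/funext => x; rewrite big_nil.
have [Pi|Pi] := boolP (P i); last first.
  by rewrite (_ : (fun _ => _) = fun x => \sum_(j <- r | P j) f j x) //;
    apply/funext => x; rewrite big_cons (negbTE Pi).
rewrite (_ : (fun _ => _) = fun x => f i x + \sum_(j <- r | P j) f j x).
  by move=> x; apply: cvgD; [exact: H | exact: IH].
by apply/funext => x; rewrite big_cons Pi.
Qed.

Section RealFunctions.
Variables (X : topologicalType) (u v : X -> R).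

Lemma cont_add : continuous u -> continuous v -> continuous (fun x => u x + v x).
Proof. by move=> cu cv x; exact: (cvgD (cu x) (cv x)). Qed.

Lemma cont_sub : continuous u -> continuous v -> continuous (fun x => u x - v x).
Proof. by move=> cu cv x; exact: (cvgB (cu x) (cv x)). Qed.

Lemma cont_mul : continuous u -> continuous v -> continuous (fun x => u x * v x).
Proof. by move=> cu cv x; exact: (cvgM (cu x) (cv x)). Qed.

End RealFunctions.

End Rows.

Section Realizations.
Variable R : realType.

Lemma realizationP n (F : {set {set 'I_n}}) (t : 'rV[R]_n) :
  realization R (Tricomplex F) t <->
  [/\ forall i, 0 <= t 0 i, \sum_i t 0 i = 1
    & exists2 s : {set 'I_n}, s \in F & forall i, i \notin s -> t 0 i = 0].
Proof. by []. Qed.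

Lemma homeomorphic_relabel m n (h : 'I_m -> 'I_n) (F : {set {set 'I_m}}) : injective h ->
  homeomorphic (realization R (Tricomplex F)) (realization R (Tricomplex (relabel h F))).
Proof.
move=> h_inj.
(* [f] extends coordinates by zero off the image of [h], the sum having at most one term. *)
pose f (t : 'rV[R]_m) : 'rV[R]_n := \row_j \sum_(i | h i == j) t 0 i.
pose g (q : 'rV[R]_n) : 'rV[R]_m := \row_i q 0 (h i).
have cf : continuous f.
  apply: continuous_row => j; rewrite (_ : (fun _ => _) = fun t : 'rV[R]_m => \sum_(i | h i == j) t 0 i).
    by apply: continuous_sumr => i; exact: coord_row.
  by apply/funext => t; rewrite mxE.
have cg : continuous g.
  apply: continuous_row => j; rewrite (_ : (fun _ => _) = fun t : 'rV[R]_n => t 0 (h j)).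
    exact: coord_row.
  by apply/funext => t; rewrite mxE.
have gf t : g (f t) = t.
  apply/rowP => i; rewrite !mxE (big_pred1 i) // => j; exact: inj_eq.
have out q j : realization R (Tricomplex (relabel h F)) q -> j \notin codom h -> q 0 j = 0.
  move=> [_ _ [s' /imsetP [s sF ->] q0]] jh; apply: q0.
  by apply: contra jh => /imsetP [i _ ->]; exact: codom_f.
exists f, g; split=> [|t [t0 t1 [s sF ts]]|q rq|t _|q rq].
- by split; exact: continuous_subspaceT.
- apply/realizationP; split=> [j||].
  + by rewrite mxE; apply: sumr_ge0.
  + rewrite -t1 [RHS](partition_big h predT) //=; apply: eq_bigr => j _.
    by rewrite mxE.
  exists (h @: s); first exact: imset_f.
  move=> j js; rewrite mxE big1 // => i /eqP hi; apply: ts.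
  by apply: contra js => si; rewrite -hi; exact: imset_f.
- apply/realizationP; have [q0 q1 [s' s'F qs]] := rq; split=> [i||].
  + by rewrite mxE; exact: q0.
  + rewrite -q1 (bigID (fun j => j \in codom h)) /= [X in _ = _ + X]big1 ?addr0; last first.
      by move=> j; exact: out.
    rewrite (eq_bigl (fun j => j \in h @: [set: 'I_m]%SET)); last first.
      move=> j; apply/codomP/imsetP => [[i ->]|[i _ ->]]; first by exists i; rewrite ?inE.
      by exists i.
    rewrite big_imset /=; last by move=> i j _ _; exact: h_inj.
    by apply: eq_big => [i|i _]; rewrite ?finset.in_setT ?mxE.
  case/imsetP: s'F => s sF e; exists s => // i si; rewrite mxE; apply: qs.
  by rewrite e (mem_imset _ _ h_inj).
- exact: gf.
- apply/rowP => j; rewrite !mxE.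
  have [/codomP [i ->]|jh] := boolP (j \in codom h).
    rewrite (big_pred1 i) ?mxE // => k; exact: inj_eq.
  rewrite (out _ _ rq jh) big_pred0 // => i; apply: contraNF jh => /eqP <-.
  exact: codom_f.
Qed.

Lemma sum_deltar n (i : 'I_n) (c : R) : \sum_j (j == i)%:R * c = c.
Proof.
rewrite (bigD1 i) //= eqxx mul1r big1 ?addr0 // => j /negbTE ->.
exact: mul0r.
Qed.

(** The label [m] stands for the midpoint of [a] and [b]. With [mn] the smaller of the weights of
    [a] and [b], the part [mn] of each is moved to [m], which receives twice [mn]. In the other
    direction, [m] returns half of its weight to each of them. *)
Lemma homeomorphic_subdiv n (F : {set {set 'I_n}}) a b m :
  (forall f, f \in F -> m \notin f) -> a != b -> a != m -> b != m ->
  homeomorphic (realization R (Tricomplex F)) (realization R (Tricomplex (subdiv F a b m))).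
Proof.
move=> mF ab am bm.
pose mn (t : 'rV[R]_n) := Num.min (t 0 a) (t 0 b).
(* Subtracting [t 0 m] makes the new weight of [m] equal to [mn t + mn t] on the whole space. *)
pose f (t : 'rV[R]_n) : 'rV[R]_n := \row_j (t 0 j + (j == m)%:R * (mn t + mn t - t 0 m)
   - (j == a)%:R * mn t - (j == b)%:R * mn t).
pose g (t : 'rV[R]_n) : 'rV[R]_n := \row_j (t 0 j - (j == m)%:R * t 0 m
   + (j == a)%:R * (t 0 m / 2) + (j == b)%:R * (t 0 m / 2)).
have fm t : f t 0 m = mn t + mn t.
  by rewrite mxE eqxx !(eq_sym m) (negbTE am) (negbTE bm) /=; lra.
have fa t : f t 0 a = t 0 a - mn t.
  by rewrite mxE eqxx (negbTE am) (negbTE ab) /=; lra.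
have fb t : f t 0 b = t 0 b - mn t.
  by rewrite mxE eqxx (negbTE bm) eq_sym (negbTE ab) /=; lra.
have fo t j : j != m -> j != a -> j != b -> f t 0 j = t 0 j.
  by move=> /negbTE jm /negbTE ja /negbTE jb; rewrite mxE jm ja jb /=; lra.
have gm t : g t 0 m = 0.
  by rewrite mxE eqxx !(eq_sym m) (negbTE am) (negbTE bm) /=; lra.
have ga t : g t 0 a = t 0 a + t 0 m / 2.
  by rewrite mxE eqxx (negbTE am) (negbTE ab) /=; lra.
have gb t : g t 0 b = t 0 b + t 0 m / 2.
  by rewrite mxE eqxx (negbTE bm) eq_sym (negbTE ab) /=; lra.
have go t j : j != m -> j != a -> j != b -> g t 0 j = t 0 j.
  by move=> /negbTE jm /negbTE ja /negbTE jb; rewrite mxE jm ja jb /=; lra.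
have cc j : continuous (fun t : 'rV[R]_n => t 0 j) by exact: coord_row.
have cmn : continuous mn.
  by move=> t; apply: continuous_min; exact: cc.
have cM (k : R) (u : 'rV[R]_n -> R) : continuous u -> continuous (fun t => k * u t).
  by move=> cu; apply: cont_mul => //; exact: cst_continuous.
have cf : continuous f.
  apply: continuous_row => j; rewrite (_ : (fun _ => _) = fun t : 'rV[R]_n =>
    t 0 j + (j == m)%:R * (mn t + mn t - t 0 m) - (j == a)%:R * mn t - (j == b)%:R * mn t).
    apply: cont_sub; last exact: cM.
    apply: cont_sub; last exact: cM.
    apply: cont_add => //; apply: cM; apply: cont_sub => //.
    exact: cont_add.
  by apply/funext => t; rewrite mxE.
have cg : continuous g.
  apply: continuous_row => j; rewrite (_ : (fun _ => _) = fun t : 'rV[R]_n =>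
    t 0 j - (j == m)%:R * t 0 m + (j == a)%:R * (t 0 m / 2) + (j == b)%:R * (t 0 m / 2)).
    have c2 : continuous (fun t : 'rV[R]_n => t 0 m / 2).
      by apply: cont_mul => //; exact: cst_continuous.
    apply: cont_add; last exact: cM.
    apply: cont_add; last exact: cM.
    by apply: cont_sub => //; exact: cM.
  by apply/funext => t; rewrite mxE.
have eqr (t t' : 'rV[R]_n) : t 0 m = t' 0 m -> t 0 a = t' 0 a -> t 0 b = t' 0 b ->
    (forall j, j != m -> j != a -> j != b -> t 0 j = t' 0 j) -> t = t'.
  move=> em ea eb eo; apply/rowP => j.
  have [->//|jm] := eqVneq j m; have [->//|ja] := eqVneq j a.
  by have [->//|jb] := eqVneq j b; exact: eo.
exists f, g; split=> [|t [t0 t1 [s sF ts]]|t [t0 t1 [s sF ts]]|t [t0 t1 [s sF ts]]|t [t0 t1 [s sF ts]]].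
- by split; exact: continuous_subspaceT.
- have tm : t 0 m = 0 by apply/ts/mF.
  have mn0 : 0 <= mn t by rewrite le_min !t0.
  have mna : mn t <= t 0 a by rewrite ge_min lexx.
  have mnb : mn t <= t 0 b by rewrite ge_min lexx orbT.
  apply/realizationP; split=> [j||].
  + have [->|jm] := eqVneq j m; first by rewrite fm; lra.
    have [->|ja] := eqVneq j a; first by rewrite fa; lra.
    have [->|jb] := eqVneq j b; first by rewrite fb; lra.
    by rewrite fo.
  + under eq_bigr do rewrite mxE; rewrite !sumrB big_split /= !sum_deltar t1 tm; lra.
  have [/andP[sa sb]|nab] := boolP ((a \in s) && (b \in s)); last first.
    have mn00 : mn t = 0.
      apply/eqP; rewrite eq_le mn0 andbT; move: nab; rewrite negb_and => /orP[] /ts <- //.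
    exists s; first by rewrite inE (negbTE (mF _ sF)) sF nab.
    by move=> j js; rewrite mxE mn00 tm ts //; lra.
  (* The vertex of smaller weight leaves the support, and [m] takes its place in the face. *)
  have [le|le] := leP (t 0 a) (t 0 b).
    have mE : mn t = t 0 a by rewrite /mn minEle le.
    exists (m |: (s :\ a))%SET; first rewrite !inE eqxx (negbTE am) (negbTE bm) /=.
      rewrite eqxx sb eq_sym ab /=.
      rewrite (_ : (a |: _)%SET = s) //; apply/setP => j; rewrite !inE.
      have [->//|ja] := eqVneq j a; have [->//|jb] := eqVneq j b => /=.
      by have [->|jm] //= := eqVneq j m; rewrite (negbTE (mF _ sF)).
    move=> j; rewrite !inE negb_or negb_and negbK => /andP[jm /orP[/eqP ->|js]].
      by rewrite fa mE; lra.
    have [->|ja] := eqVneq j a; first by rewrite fa mE; lra.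
    by rewrite fo ?ts //; apply: contraNneq js => ->.
  have mE : mn t = t 0 b by rewrite /mn minElt ltNge (ltW le).
  exists (m |: (s :\ b))%SET; first rewrite !inE eqxx (negbTE am) (negbTE bm) /=.
    rewrite eqxx sa ab /=.
    rewrite (_ : (a |: _)%SET = s) //; apply/setP => j; rewrite !inE.
    have [->//|ja] := eqVneq j a; have [->//|jb] := eqVneq j b => /=.
    by have [->|jm] //= := eqVneq j m; rewrite (negbTE (mF _ sF)).
  move=> j; rewrite !inE negb_or negb_and negbK => /andP[jm /orP[/eqP ->|js]].
    by rewrite fb mE; lra.
  have [->|jb] := eqVneq j b; first by rewrite fb mE; lra.
  by rewrite fo ?ts //; apply: contraNneq js => ->.
- apply/realizationP; split=> [j||].
  + have tm0 := t0 m; have ta0 := t0 a; have tb0 := t0 b.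
    have [->|jm] := eqVneq j m; first by rewrite gm.
    have [->|ja] := eqVneq j a; first by rewrite ga; lra.
    have [->|jb] := eqVneq j b; first by rewrite gb; lra.
    by rewrite go.
  + under eq_bigr do rewrite mxE; rewrite !big_split /= sumrN !sum_deltar t1; lra.
  move: sF; rewrite inE; case: ifP => [ms /andP[sab sF]|/negbT ms /andP[sF sab]].
    exists (a |: (b |: s :\ m))%SET => // j; rewrite !inE !negb_or => /and3P[ja jb].
    rewrite negb_and negbK => js; have [->|jm] := eqVneq j m; first by rewrite gm.
    by rewrite go // ts //; move: js; rewrite (negbTE jm).
  exists s => // j js; have [->|jm] := eqVneq j m; first by rewrite gm.
  have [ja|ja] := eqVneq j a; first by rewrite ja ga -ja !ts //; lra.
  have [jb|jb] := eqVneq j b; first by rewrite jb gb -jb !ts //; lra.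
  by rewrite go // ts.
- have tm : t 0 m = 0 by apply/ts/mF.
  by apply: eqr; rewrite ?gm ?ga ?gb ?fa ?fb ?fm //; [lra|lra|] => j *; rewrite go // fo.
have mnE : mn (g t) = t 0 m / 2.
  (* No face of the subdivision contains both [a] and [b]. *)
  have tab : t 0 a = 0 \/ t 0 b = 0.
    move: sF; rewrite inE; case: ifP => _ /andP[].
      case sa: (a \in s); case sb: (b \in s) => // _ _.
        by right; apply: ts; rewrite sb.
      by left; apply: ts; rewrite sa.
    by move=> _; rewrite negb_and => /orP[] /ts; [left|right].
  have ta0 := t0 a; have tb0 := t0 b.
  by rewrite /mn ga gb; case: tab => ->; rewrite minEle; case: leP; lra.
by apply: eqr; rewrite ?fa ?fb ?fm ?ga ?gb ?mnE; [lra|lra|lra|] => j *; rewrite fo // go.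
Qed.

End Realizations.

(** * The octahedron and the round sphere *)

Section OctahedronSphere.
Variable R : realType.

Let pos (k : 'I_3) : 'I_6 := inord k.*2.
Let neg (k : 'I_3) : 'I_6 := inord k.*2.+1.

Lemma antipode_pos k : antipode_class (pos k) = k.
Proof.
apply/eqP; rewrite antipode_classE /pos.
by case: k => [[|[|[|k]]] ?] //=; rewrite inordK.
Qed.

Lemma antipode_neg k : antipode_class (neg k) = k.
Proof.
apply/eqP; rewrite antipode_classE /neg.
by case: k => [[|[|[|k]]] ?] //=; rewrite inordK.
Qed.

Lemma pos_neq_neg k : pos k != neg k.
Proof. by rewrite -val_eqE /pos /neg; case: k => [[|[|[|k]]] ?] //=; rewrite !inordK. Qed.

Lemma pos_or_neg i : i = pos (antipode_class i) \/ i = neg (antipode_class i).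
Proof.
have ci : (antipode_class i : nat) = (i %/ 2)%N.
  by rewrite /antipode_class inordK //; case: i => [[|[|[|[|[|[|i]]]]]] ?].
rewrite /pos /neg ci; case: i {ci} => [[|[|[|[|[|[|i]]]]]] ?] //=;
  by [left; apply/val_inj; rewrite /= inordK | right; apply/val_inj; rewrite /= inordK].
Qed.

Lemma sum_oct (u : 'I_6 -> R) : \sum_i u i = \sum_k (u (pos k) + u (neg k)).
Proof.
rewrite (eq_bigr (fun i : 'I_6 => u (inord i))); last by move=> i _; rewrite inord_val.
rewrite /pos /neg !big_ord_recr !big_ord0 /=; lra.
Qed.

Lemma realization_octP (t : 'rV[R]_6) : realization R octahedral_sphere t <->
  [/\ forall i, 0 <= t 0 i, \sum_i t 0 i = 1
    & forall k, t 0 (pos k) = 0 \/ t 0 (neg k) = 0].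
Proof.
split=> [[t0 t1 [s sO ts]]|[t0 t1 tk]]; split=> //.
  move=> k; have /eqP/cards1P [p pE] := elimT (oct_faceP _) sO k.
  have [ps|ps] := boolP (pos k \in s); last by left; exact: ts.
  have [ns|ns] := boolP (neg k \in s); last by right; exact: ts.
  have : pos k \in [set p]%SET by rewrite -pE inE ps antipode_pos eqxx.
  have : neg k \in [set p]%SET by rewrite -pE inE ns antipode_neg eqxx.
  rewrite !finset.in_set1 => /eqP e1 /eqP e2.
  by have := pos_neq_neg k; rewrite e1 e2 eqxx.
(* From each antipodal pair take the vertex that may carry weight. *)
pose x k := if t 0 (pos k) == 0 then neg k else pos k.
have xk k : antipode_class (x k) = k.
  by rewrite /x; case: ifP => _; rewrite ?antipode_neg ?antipode_pos.
exists (x @: [set: 'I_3]%SET).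
  apply/oct_faceP => k; apply/eqP/cards1P; exists (x k).
  apply/setP => i; rewrite !inE; apply/andP/eqP => [[/imsetP [j _ ->]]|->].
    by rewrite xk => /eqP ->.
  by rewrite xk eqxx; split=> //; apply: imset_f; rewrite finset.in_setT.
move=> i ni; have nx : i != x (antipode_class i).
  by apply: contraNneq ni => ->; apply: imset_f; rewrite finset.in_setT.
move: nx; rewrite /x; case: (pos_or_neg i) => e; case: ifP => c.
- by move: c; rewrite -e => /eqP.
- by rewrite -e eqxx.
- by rewrite -e eqxx.
- by case: (tk (antipode_class i)) => e'; [rewrite e' eqxx in c | rewrite e].
Qed.

(** The map [p] places the realization in space as the boundary of the cross-polytope, which is the
    unit sphere of the sum norm [N]; [r] is the Euclidean norm after [p]. *)
Let p (t : 'rV[R]_6) k := t 0 (pos k) - t 0 (neg k).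
Let r t := Num.sqrt (\sum_k p t k ^+ 2).
Let N (P : 'rV[R]_3) := \sum_k `|P 0 k|.

Lemma cvg_within_at (X Y : topologicalType) (A : set X) (f : X -> Y) :
  (forall x, A x -> f @ x --> f x) -> {within A, continuous f}.
Proof.
move=> H; apply/subspace_continuousP => x Ax.
by apply: cvg_within_filter; exact: H.
Qed.

(** Radial projection between the unit spheres of the sum norm and the Euclidean norm. In the
    inverse, half of the absolute value plus the signed coordinate is its positive or negative part,
    according to the vertex. *)
Lemma octahedron_sphere : homeomorphic (realization R octahedral_sphere) (sphere2 R).
Proof.
have cp k : continuous (fun t => p t k) by apply: cont_sub; exact: coord_row.
have cr : continuous r.
  move=> t; apply: (@continuous_comp _ _ _ (fun t => \sum_k p t k ^+ 2) (@Num.sqrt R)).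
    apply: continuous_sumr => k.
    by rewrite (_ : (fun _ => _) = fun t => p t k * p t k) //; exact: cont_mul.
  exact: sqrt_continuous.
have cN : continuous N.
  apply: continuous_sumr => k x.
  exact: (cvg_norm (@coord_row R 3 k x)).
pose sg (i : 'I_6) : R := if i == pos (antipode_class i) then 1 else -1.
have sgp k : sg (pos k) = 1 by rewrite /sg antipode_pos eqxx.
have sgn k : sg (neg k) = -1 by rewrite /sg antipode_neg eq_sym (negbTE (pos_neq_neg k)).
pose f t : 'rV[R]_3 := \row_k (p t k / r t).
pose g (P : 'rV[R]_3) : 'rV[R]_6 := \row_i
  ((`|P 0 (antipode_class i)| + sg i * P 0 (antipode_class i)) / 2 / N P).
have absp t k : realization R octahedral_sphere t -> `|p t k| = t 0 (pos k) + t 0 (neg k).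
  move=> /realization_octP [t0 _ /(_ k) [e|e]]; rewrite /p e ?sub0r ?add0r ?subr0 ?addr0 ?normrN;
    exact: ger0_norm.
have sump t : realization R octahedral_sphere t -> \sum_k `|p t k| = 1.
  move=> rt; have [_ <- _] := (realization_octP t).1 rt; rewrite sum_oct.
  by apply: eq_bigr => k _; exact: absp.
have sqge0 (u : 'I_3 -> R) : 0 <= \sum_k u k ^+ 2 by apply: sumr_ge0 => k _; exact: sqr_ge0.
have rgt0 t : realization R octahedral_sphere t -> 0 < r t.
  move=> rt; rewrite sqrtr_gt0 lt_neqAle sqge0 andbT eq_sym; apply/negP => /eqP e.
  have := sump _ rt; rewrite big1 => [/eqP|k _]; first by rewrite eq_sym oner_eq0.
  have /eqP := e; rewrite psumr_eq0 => [/allP /(_ k)|j _]; last exact: sqr_ge0.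
  by rewrite mem_index_enum sqrf_eq0 => /(_ isT) /eqP ->; rewrite normr0.
have NgtO P : sphere2 R P -> 0 < N P.
  move=> sP; rewrite lt_neqAle sumr_ge0 // andbT eq_sym; apply/negP => /eqP e.
  have : \sum_i P 0 i ^+ 2 = 1 by [].
  rewrite big1 => [/eqP|k _]; first by rewrite eq_sym oner_eq0.
  have /eqP := e; rewrite psumr_eq0 // => /allP /(_ k).
  by rewrite mem_index_enum normr_eq0 => /(_ isT) /eqP ->; rewrite expr0n.
have pg P k : p (g P) k = P 0 k / N P.
  by rewrite /p !mxE antipode_pos antipode_neg sgp sgn; lra.
exists f, g; split=> [|t rt|P sP|t rt|P sP].
- split; apply: cvg_within_at.
    move=> t rt; apply: (@cvg_row R _ (nbhs t)) => k.
    under eq_fun do rewrite mxE; rewrite mxE.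
    exact: (cvgM (cp k t) (cvgV (lt0r_neq0 (rgt0 _ rt)) (cr t))).
  move=> P sP; apply: (@cvg_row R _ (nbhs P)) => k.
  pose w (Q : 'rV[R]_3) := (`|Q 0 (antipode_class k)| + sg k * Q 0 (antipode_class k)) / 2.
  have cw : continuous w.
    apply: cont_mul; last exact: cst_continuous.
    apply: cont_add; first by move=> Q; exact: (cvg_norm (@coord_row R 3 _ Q)).
    by apply: cont_mul; [exact: cst_continuous | exact: coord_row].
  rewrite (_ : (fun Q => g Q 0 k) = fun Q => w Q / N Q); last by apply/funext => Q; rewrite mxE.
  rewrite mxE; exact: (cvgM (cw P) (cvgV (lt0r_neq0 (NgtO _ sP)) (cN P))).
- rewrite /sphere2 /=; under eq_bigr do rewrite mxE exprMn exprVn.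
  rewrite -mulr_suml sqr_sqrtr ?sqge0 // divff //.
  by rewrite -(sqr_sqrtr (sqge0 (p t))) expf_neq0 // lt0r_neq0 // rgt0.
- have N0 := NgtO _ sP; apply/realization_octP; split=> [i||k].
  + rewrite mxE; apply: divr_ge0; last exact: ltW.
    apply: divr_ge0 => //; rewrite /sg; case: ifP => _; rewrite ?mul1r ?mulN1r.
      by have := ler_norm (- P 0 (antipode_class i)); rewrite normrN; lra.
    by have := ler_norm (P 0 (antipode_class i)); lra.
  + rewrite sum_oct -[RHS](divff (lt0r_neq0 N0)) {2}/N mulr_suml; apply: eq_bigr => k _.
    by rewrite !mxE antipode_pos antipode_neg sgp sgn; lra.
  + rewrite !mxE antipode_pos antipode_neg sgp sgn.
    have [h|h] := leP 0 (P 0 k).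
      by right; rewrite ger0_norm // mulN1r subrr !mul0r.
    by left; rewrite ltr0_norm // mul1r addNr !mul0r.
- have r0 := rgt0 _ rt; apply/rowP => i; rewrite mxE.
  have -> : N (f t) = (r t)^-1.
    rewrite /N -[RHS]mul1r -(sump _ rt) mulr_suml; apply: eq_bigr => k _.
    by rewrite mxE normrM normfV (gtr0_norm r0).
  rewrite invrK mxE normrM normfV (gtr0_norm r0) absp //.
  set k := antipode_class i; have rn := lt0r_neq0 r0.
  rewrite (_ : _ * r t = (t 0 (pos k) + t 0 (neg k) + sg i * p t k) / 2); last by field.
  rewrite /p.
  by case: (pos_or_neg i) => ->; rewrite -/k ?sgp ?sgn; lra.
have N0 := NgtO _ sP; have Nn := lt0r_neq0 N0; apply/rowP => k; rewrite mxE pg.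
have -> : r (g P) = (N P)^-1.
  rewrite /r; under eq_bigr do rewrite pg exprMn.
  rewrite -mulr_suml (_ : \sum_i _ = 1); last exact: sP.
  by rewrite mul1r sqrtr_sqr ger0_norm // invr_ge0 ltW.
by rewrite invrK mulfVK.
Qed.

End OctahedronSphere.

(** * Double covers of the sphere *)

Lemma connected_locally_constant (X : topologicalType) (A : set X) (d : X -> bool) :
  connected A -> (forall x, A x -> \forall y \near x, A y -> d y = d x) ->
  forall x y, A x -> A y -> d x = d y.
Proof.
move=> cA ld x y Ax Ay.
suff : A `&` [set z | d z = d x] = A.
  by move=> E; have : A y by []; rewrite -E => -[_ ->].
apply: cA.
- by exists x.
- exists (interior [set z | A z -> d z = d x]); first exact: open_interior.
  apply/seteqP; split=> z [Az dz]; split=> //.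
    by apply: filterS (ld _ Az) => w H Aw; rewrite H // dz.
  exact: (interior_subset dz Az).
- exists (~` interior [set z | A z -> d z != d x]); first exact/open_closedC/open_interior.
  apply/seteqP; split=> z [Az dz]; split=> //.
    by move=> /interior_subset /(_ Az); rewrite /= dz eqxx.
  apply: contrapT => nd; apply: dz.
  by apply: filterS (ld _ Az) => w H Aw; rewrite H //; exact/eqP.
Qed.

Section Sections.
Variables (R : realType) (n : nat) (F : {set {set 'I_n}}) (al : 'I_n -> 'I_n -> bool).
Hypothesis al_cocycle : cocycle F al.

(* A point of [X] is mapped to a point of the complex with barycentric
   coordinates [q x]. The cocycle [al] glues the sets [0 < q x i], taken twice, to
   a double cover of [X]; [s] is a section of it. *)
Definition section_on (X : topologicalType) (q : X -> 'I_n -> R) (A : set X)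
    (s : X -> 'I_n -> bool) :=
  (forall x, A x -> forall i j, 0 < q x i -> 0 < q x j -> s x i (+) s x j = al i j) /\
  (forall x, A x -> forall i, 0 < q x i -> \forall y \near x, A y -> s y i = s x i).

Definition has_section (X : topologicalType) (q : X -> 'I_n -> R) (A : set X) :=
  exists s, section_on q A s.

(** Of the continuity of barycentric coordinates only the openness of the vertex stars is kept. *)
Definition chart (X : topologicalType) (q : X -> 'I_n -> R) (A : set X) :=
  forall x, A x -> [/\ exists i, 0 < q x i,
    exists2 f : {set 'I_n}, f \in F & forall i, 0 < q x i -> i \in f
    & forall i, 0 < q x i -> \forall y \near x, A y -> 0 < q y i].

Section Basics.
Variables (X : topologicalType) (q : X -> 'I_n -> R).
Implicit Types A B : set X.

Lemma has_sectionW A B : B `<=` A -> has_section q A -> has_section q B.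
Proof.
move=> BA [s [s1 s2]]; exists s; split=> x /BA Ax; first exact: s1.
by move=> i qi; apply: filterS (s2 _ Ax _ qi) => y H /BA.
Qed.

Lemma chartW A B : B `<=` A -> chart q A -> chart q B.
Proof.
move=> BA H x /BA /H [h1 h2 h3]; split=> // i qi.
by apply: filterS (h3 _ qi) => y K /BA.
Qed.

(** Over the open star of [i0] the cover is trivialized by transport from one sheet at [i0]. *)
Lemma local_section A i0 : chart q A -> (forall x, A x -> 0 < q x i0) -> has_section q A.
Proof.
move=> cA q0; exists (fun _ i => al i0 i); split=> x Ax; last by move=> i _; near=> y.
move=> i j qi qj; have [_ [f fF sf] _] := cA _ Ax.
have fi0 := sf _ (q0 _ Ax); have fi := sf _ qi; have fj := sf _ qj.
rewrite -(al_cocycle fF fi0 fi fj).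
by case: (al i0 i); case: (al i j).
Unshelve. all: by end_near. Qed.

(** On the connected intersection the two sections differ by a constant [e], which is added to one
    of them. At a point of only one of the two closed sets, a neighborhood avoids the other, so the
    glued section is locally constant there too. *)
Lemma glue_sections A B : closed A -> closed B -> connected (A `&` B) ->
  chart q (A `|` B) -> has_section q A -> has_section q B -> has_section q (A `|` B).
Proof.
move=> cA cB cAB ch [s1 [s11 s12]] [s2 [s21 s22]].
(* The difference at [x] is the same for all [i] in the support, since along [ij] both sections
   change by [al i j]. *)
pose d x := if [pick i | 0 < q x i] is Some i then s1 x i (+) s2 x i else false.
have dE x i : (A `&` B) x -> 0 < q x i -> d x = s1 x i (+) s2 x i.
  move=> [Ax Bx] qi; rewrite /d; case: pickP => [j qj|/(_ i)]; last by rewrite qi.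
  have := s11 _ Ax _ _ qi qj; rewrite -(s21 _ Bx _ _ qi qj).
  by case: (s1 x i); case: (s1 x j); case: (s2 x i); case: (s2 x j).
have [e eP] : exists e, forall x, (A `&` B) x -> d x = e.
  have [[x0 ABx0]|none] := pselect (A `&` B !=set0); last first.
    by exists false => x ABx; case: none; exists x.
  exists (d x0) => x ABx; apply: (connected_locally_constant cAB) => // {x ABx} x ABx.
  have [Ax Bx] := ABx; have [[i qi] _ op] := ch _ (or_introl Ax).
  near=> y => ABy; have [Ay By] := ABy.
  have qy : 0 < q y i by (have : (A `|` B) y -> 0 < q y i by near: y; exact: op); apply; left.
  rewrite (dE _ _ ABx qi) (dE _ _ ABy qy); congr addb.
    by (have : A y -> s1 y i = s1 x i by near: y; exact: s12); apply.
  by (have : B y -> s2 y i = s2 x i by near: y; exact: s22); apply.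
have {}eP x i : A x -> B x -> 0 < q x i -> s2 x i (+) e = s1 x i.
  move=> Ax Bx qi; rewrite -(eP x) // (dE x i) //.
  by case: (s1 x i); case: (s2 x i).
exists (fun x i => if x \in A then s1 x i else s2 x i (+) e); split=> x ABx.
  move=> i j qi qj; case: ifPn => [/set_mem Ax|nA]; first exact: s11.
  have Bx : B x by case: ABx => // Ax; rewrite mem_set in nA.
  rewrite -(s21 _ Bx _ _ qi qj).
  by case: (s2 x i); case: (s2 x j); case: (e).
move=> i qi; have [Ax|nAx] := pselect (A x); last first.
  have Bx : B x by case: ABx.
  have nA : \forall y \near x, ~ A y.
    by apply: open_nbhs_nbhs; split=> //; exact: closed_openC.
  rewrite (memNset nAx); near=> y => -[Ay|By].
    by have [] : ~ A y by near: y.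
  rewrite memNset; last by near: y.
  by congr addb; (have : B y -> s2 y i = s2 x i by near: y; exact: s22); apply.
rewrite (mem_set Ax).
have [Bx|nBx] := pselect (B x).
  near=> y => ABy; case: ifPn => [/set_mem Ay|nA].
    by (have : A y -> s1 y i = s1 x i by near: y; exact: s12); apply.
  have By : B y by case: ABy => // Ay; rewrite mem_set in nA.
  rewrite -(eP _ _ Ax Bx qi); congr addb.
  by (have : B y -> s2 y i = s2 x i by near: y; exact: s22); apply.
have nB : \forall y \near x, ~ B y.
  by apply: open_nbhs_nbhs; split=> //; exact: closed_openC.
near=> y => -[Ay|By].
  rewrite mem_set //.
  by (have : A y -> s1 y i = s1 x i by near: y; exact: s12); apply.
by have [] : ~ B y by near: y.
Unshelve. all: by end_near. Qed.

End Basics.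

Section Pullback.
Variables (X Y : topologicalType) (q : X -> 'I_n -> R) (A : set X) (B : set Y).
Variables (q' : Y -> 'I_n -> R) (phi : Y -> X).
Hypotheses (cphi : {within B, continuous phi}) (BA : forall y, B y -> A (phi y)).
Hypothesis (qE : forall y, B y -> q' y = q (phi y)).

Let pull (P : X -> Prop) y : B y -> (\forall x \near phi y, A x -> P x) ->
  \forall y' \near y, B y' -> P (phi y').
Proof.
move=> By H; have /subspace_continuousP c := cphi; have := c _ By _ H.
rewrite /nbhs /= /within /= => {}H.
by apply: (@filterS _ (nbhs y)) H => z H Bz; exact: H Bz (BA Bz).
Qed.

Lemma chart_pullback : chart q A -> chart q' B.
Proof.
move=> ch y By; have [[i qi] [f fF sf] op] := ch _ (BA By); rewrite qE //.
split; [by exists i | by exists f |] => j qj.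
by apply: filterS (pull By (op _ qj)) => z H Bz; rewrite qE //; exact: H.
Qed.

Lemma section_pullback : has_section q A -> has_section q' B.
Proof.
case=> s [s1 s2]; exists (fun y => s (phi y)); split=> y By; rewrite qE //.
  exact: s1 (BA By).
move=> i qi; exact: (@pull (fun x => s x i = s (phi y) i)) By (s2 _ (BA By) _ qi).
Qed.

End Pullback.

End Sections.

(** This plays the role of a Lebesgue number: the supremum [c] of the endpoints reached from [a] is
    itself reached, and the local hypothesis at [c] leads beyond it unless [c = b]. *)
Lemma interval_induction (R : realType) (P : R -> R -> Prop) a b : a <= b ->
  (forall x y z, x <= y -> y <= z -> P x y -> P y z -> P x z) ->
  (forall t, a <= t <= b -> exists2 e, 0 < e & forall x y, x <= t -> t <= y ->
     t - e < x -> y < t + e -> P x y) -> P a b.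
Proof.
move=> ab add loc.
pose S := [set t | a <= t <= b /\ P a t].
have Sa : S a.
  split; first by rewrite lexx.
  by have [|e e0 H] := loc a; [rewrite lexx | apply: H; lra].
have Sb : ubound S b by move=> t [/andP[]].
have hS : has_sup S by split; [exists a | exists b].
pose c := sup S.
have ac : a <= c by apply: ub_le_sup => //; exists b.
have cb : c <= b by apply: ge_sup => //; exists a.
have [|e e0 H] := loc c; first by rewrite ac cb.
have [t [/andP[at_ tb] Pat] tc] := sup_adherent e0 hS.
have tc' : t <= c by apply: ub_le_sup; [exists b | split=> //; rewrite at_ tb].
(* [y] is again reached from [a], so [y <= c], which is possible only if the minimum is [b]. *)
pose y := Num.min b (c + e / 2).
have cy : c <= y by rewrite le_min cb; lra.
have yb : y <= b by rewrite ge_min lexx.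
have ye : y <= c + e / 2 by rewrite ge_min lexx orbT.
have Pty : P t y by apply: H => //; lra.
have Pay : P a y by apply: add Pat Pty => //; lra.
have yc : y <= c.
  by apply: ub_le_sup; [exists b | split=> //; rewrite yb andbT; lra].
have -> // : b = y.
apply/eqP; rewrite eq_le yb andbT /y le_min lexx /= leNgt; apply/negP => h.
by move: yc; rewrite /y min_r ?(ltW h) //; lra.
Qed.

Section Square.
Variables (R : realType) (n : nat) (F : {set {set 'I_n}}) (al : 'I_n -> 'I_n -> bool).
Hypothesis al_cocycle : cocycle F al.
Variable (q : (R * R)%type -> 'I_n -> R).
Hypothesis chq : chart F q setT.

Definition rect (a b c d : R) : set (R * R)%type :=
  [set p | a <= p.1 <= b /\ c <= p.2 <= d].

Lemma closed_rect a b c d : closed (rect a b c d).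
Proof.
have -> : rect a b c d = (fst @^-1` `[a, b]) `&` (snd @^-1` `[c, d]).
  by apply/seteqP; split=> p; rewrite /rect /= !in_itv.
apply: closedI; apply: closed_comp.
- by move=> p _; exact: cvg_fst.
- exact: itv_closed.
- by move=> p _; exact: cvg_snd.
- exact: itv_closed.
Qed.

Lemma connected_vertical a c d : connected (rect a a c d).
Proof.
have -> : rect a a c d = (fun t => (a, t)) @` `[c, d].
  apply/seteqP; split=> [[p1 p2] [/= p1a p2c]|_ [t /= tc <-]].
    exists p2; first by rewrite /= in_itv.
    by congr pair; apply: le_anti.
  by split; rewrite /= ?lexx //; move: tc; rewrite in_itv.
apply: connected_continuous_connected; first exact: segment_connected.
apply: continuous_subspaceT => t; exact: (cvg_pair (cvg_cst a) cvg_id).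
Qed.

Lemma connected_horizontal a b c : connected (rect a b c c).
Proof.
have -> : rect a b c c = (fun t => (t, c)) @` `[a, b].
  apply/seteqP; split=> [[p1 p2] [/= p1a p2c]|_ [t /= tc <-]].
    exists p1; first by rewrite /= in_itv.
    by congr pair; apply: le_anti.
  by split; rewrite /= ?lexx //; move: tc; rewrite in_itv.
apply: connected_continuous_connected; first exact: segment_connected.
apply: continuous_subspaceT => t; exact: (cvg_pair cvg_id (cvg_cst c)).
Qed.

(** Two nested inductions: small rectangles are stacked to a strip of full height, and strips are
    put side by side. Neighbors meet in a segment, which is connected. *)
Lemma rect_section a b c d : a <= b -> c <= d -> has_section al q (rect a b c d).
Proof.
move=> ab cd; pose P x y := has_section al q (rect x y c d).
apply: (@interval_induction _ P) => // [x y z xy yz s1 s2|t _].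
  have E : rect x y c d `|` rect y z c d = rect x z c d.
    apply/seteqP; split=> [p [] [/= /andP[h1 h2] h3]|p [/= /andP[h1 h2] h3]].
    - by split=> //; rewrite h1 (le_trans h2).
    - by split=> //; rewrite h2 (le_trans _ h1).
    by have [h|h] := leP p.1 y; [left | right]; split=> //=; rewrite ?h1 ?h2 ?h ?(ltW h).
  have EI : rect x y c d `&` rect y z c d = rect y y c d.
    apply/seteqP; split=> [p [[/= /andP[h1 h2] h3] [/= /andP[h4 h5] _]]|p [/= /andP[h1 h2] h3]].
      by split=> //; rewrite h4 h2.
    by split; split=> //=; rewrite ?h1 ?h2 ?(le_trans xy) ?(le_trans h2).
  rewrite /P -E; apply: (@glue_sections _ _ F) => //; try exact: closed_rect.
    by rewrite EI; exact: connected_vertical.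
  exact: chartW chq.
suff [e e0 H] : exists2 e, 0 < e & has_section al q (rect (t - e) (t + e) c d).
  exists e => // x y xt ty ex ye; apply: has_sectionW H => p [/= /andP[h1 h2] h3].
  by split=> //=; rewrite (le_trans (ltW ex)) // (le_trans h2) // ltW.
(* The half-width is quantified inside, since stacking two rectangles keeps only the smaller one. *)
pose Q u v := exists2 e, 0 < e & has_section al q (rect (t - e) (t + e) u v).
apply: (@interval_induction _ Q) => // [x y z xy yz [e1 e10 s1] [e2 e20 s2]|s _].
  pose e := Num.min e1 e2.
  have e0 : 0 < e by rewrite lt_min e10 e20.
  have ee1 : e <= e1 by rewrite ge_min lexx.
  have ee2 : e <= e2 by rewrite ge_min lexx orbT.
  exists e => //.
  have {}s1 : has_section al q (rect (t - e) (t + e) x y).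
    by apply: has_sectionW s1 => p [/= /andP[h1 h2] h3]; split=> //=; lra.
  have {}s2 : has_section al q (rect (t - e) (t + e) y z).
    by apply: has_sectionW s2 => p [/= /andP[h1 h2] h3]; split=> //=; lra.
  have E : rect (t - e) (t + e) x y `|` rect (t - e) (t + e) y z = rect (t - e) (t + e) x z.
    apply/seteqP; split=> [p [] [/= h3 /andP[h1 h2]]|p [/= h3 /andP[h1 h2]]].
    - by split=> //; rewrite h1 (le_trans h2).
    - by split=> //; rewrite h2 (le_trans _ h1).
    by have [h|h] := leP p.2 y; [left | right]; split=> //=; rewrite ?h1 ?h2 ?h ?(ltW h).
  have EI : rect (t - e) (t + e) x y `&` rect (t - e) (t + e) y z = rect (t - e) (t + e) y y.
    apply/seteqP; split=> [p [[/= h3 /andP[h1 h2]] [/= _ /andP[h4 h5]]]|p [/= h3 /andP[h1 h2]]].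
      by split=> //; rewrite h4 h2.
    by split; split=> //=; rewrite ?h1 ?h2 ?(le_trans xy) ?(le_trans h2).
  rewrite -E; apply: (@glue_sections _ _ F) => //; try exact: closed_rect.
    by rewrite EI; exact: connected_horizontal.
  exact: chartW chq.
(* Near [(t, s)] one coordinate stays positive, so a small rectangle lies in a single vertex
   star. *)
have [[i qi] _ op] := chq (x := (t, s)) I.
have /nbhs_ballP [e /= e0 be] := op _ qi.
exists (e / 2); first by rewrite divr_gt0.
move=> x y xs sy ex ye; exists (e / 2); first by rewrite divr_gt0.
apply: (@local_section _ _ F _ al_cocycle _ _ _ i).
  exact: chartW chq.
move=> p [/= /andP[h1 h2] /andP[h3 h4]]; apply: be => //.
by split=> /=; rewrite /ball /= ltr_norml; apply/andP; split; lra.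
Qed.

End Square.

(** * The sphere as the union of two hemispheres *)

Section Sphere.
Variable R : realType.

Let o0 : 'I_3 := inord 0.
Let o1 : 'I_3 := inord 1.
Let o2 : 'I_3 := inord 2.

Definition vec3 (x y z : R) : 'rV[R]_3 := \row_(k < 3) nth 0 [:: x; y; z] k.

Lemma sum_ord3 (u : 'I_3 -> R) : \sum_k u k = u o0 + u o1 + u o2.
Proof.
rewrite (eq_bigr (fun i : 'I_3 => u (inord i))); last by move=> i _; rewrite inord_val.
by rewrite !big_ord_recr big_ord0 /= add0r.
Qed.

Lemma vec3E x y z : [/\ vec3 x y z 0 o0 = x, vec3 x y z 0 o1 = y & vec3 x y z 0 o2 = z].
Proof. by split; rewrite mxE inordK. Qed.

Lemma vec3_eta (P : 'rV[R]_3) : P = vec3 (P 0 o0) (P 0 o1) (P 0 o2).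
Proof.
apply/rowP => k; rewrite mxE -{1}(inord_val k).
by case: k => [[|[|[|k]]] ?].
Qed.

Lemma continuous_vec3 (X : topologicalType) (f g h : X -> R) :
  continuous f -> continuous g -> continuous h ->
  continuous (fun x => vec3 (f x) (g x) (h x)).
Proof.
move=> cf cg ch; apply: continuous_row => k.
rewrite (_ : (fun _ => _) = fun x => nth 0 [:: f x; g x; h x] k).
  by case: k => [[|[|[|k]]] ?].
by apply/funext => x; rewrite mxE.
Qed.

Lemma sphere2P (P : 'rV[R]_3) :
  sphere2 R P <-> P 0 o0 ^+ 2 + P 0 o1 ^+ 2 + P 0 o2 ^+ 2 = 1.
Proof. by rewrite /sphere2 /= sum_ord3. Qed.

Lemma continuous_sqrtr (X : topologicalType) (f : X -> R) :
  continuous f -> continuous (fun x => Num.sqrt (f x)).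
Proof.
move=> cf x; apply: (@continuous_comp _ _ _ f (@Num.sqrt R)); first exact: cf.
exact: sqrt_continuous.
Qed.

Lemma continuous_sqrr (X : topologicalType) (f : X -> R) :
  continuous f -> continuous (fun x => f x ^+ 2).
Proof. by move=> cf; rewrite (_ : (fun _ => _) = fun x => f x * f x) //; exact: cont_mul. Qed.

(* Outside the unit disc the square root vanishes, and the point is pushed
   radially to the equator. *)
Definition lift_hemisphere (e : R) (p : (R * R)%type) : 'rV[R]_3 :=
  let w := Num.sqrt (1 - p.1 ^+ 2 - p.2 ^+ 2) in
  let r := Num.sqrt (p.1 ^+ 2 + p.2 ^+ 2 + w ^+ 2) in
  vec3 (p.1 / r) (p.2 / r) (e * w / r).

Lemma lift_radius (p : (R * R)%type) :
  0 < p.1 ^+ 2 + p.2 ^+ 2 + Num.sqrt (1 - p.1 ^+ 2 - p.2 ^+ 2) ^+ 2.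
Proof.
set s := 1 - _ - _; have : s <= Num.sqrt s ^+ 2.
  have [s0|s0] := leP 0 s; first by rewrite sqr_sqrtr.
  by apply: le_trans (ltW s0) _; exact: sqr_ge0.
by rewrite {1}/s; lra.
Qed.

Lemma continuous_lift_hemisphere e : continuous (lift_hemisphere e).
Proof.
have c1 : continuous (fun p : (R * R)%type => p.1) by move=> p; exact: cvg_fst.
have c2 : continuous (fun p : (R * R)%type => p.2) by move=> p; exact: cvg_snd.
have cw : continuous (fun p : (R * R)%type => Num.sqrt (1 - p.1 ^+ 2 - p.2 ^+ 2)).
  apply: continuous_sqrtr; apply: cont_sub; last exact: continuous_sqrr.
  by apply: cont_sub; [exact: cst_continuous | exact: continuous_sqrr].
have cr : continuous (fun p : (R * R)%type =>
    (Num.sqrt (p.1 ^+ 2 + p.2 ^+ 2 + Num.sqrt (1 - p.1 ^+ 2 - p.2 ^+ 2) ^+ 2))^-1).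
  move=> p; apply: cvgV; first by rewrite lt0r_neq0 // sqrtr_gt0 lift_radius.
  have : continuous (fun p : (R * R)%type =>
    Num.sqrt (p.1 ^+ 2 + p.2 ^+ 2 + Num.sqrt (1 - p.1 ^+ 2 - p.2 ^+ 2) ^+ 2)); last exact.
  apply: continuous_sqrtr; apply: cont_add; last exact: continuous_sqrr.
  by apply: cont_add; exact: continuous_sqrr.
apply: continuous_vec3; apply: cont_mul => //.
by apply: cont_mul => //; exact: cst_continuous.
Qed.

Lemma lift_hemisphere_sphere e p : e ^+ 2 = 1 -> sphere2 R (lift_hemisphere e p).
Proof.
move=> e2; apply/sphere2P; rewrite /lift_hemisphere; have := lift_radius p.
set w := Num.sqrt (1 - _ - _); set s := _ + _ + _ => s0.
have [-> -> ->] := vec3E (p.1 / Num.sqrt s) (p.2 / Num.sqrt s) (e * w / Num.sqrt s).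
rewrite !exprMn e2 mul1r exprVn sqr_sqrtr ?(ltW s0) // -!mulrDl -/s divff //.
exact: lt0r_neq0.
Qed.

Lemma lift_hemisphereK e (P : 'rV[R]_3) : e ^+ 2 = 1 -> sphere2 R P -> 0 <= e * P 0 o2 ->
  lift_hemisphere e (P 0 o0, P 0 o1) = P.
Proof.
move=> e2 /sphere2P sP eP; rewrite [RHS]vec3_eta /lift_hemisphere /=.
have -> : 1 - P 0 o0 ^+ 2 - P 0 o1 ^+ 2 = (e * P 0 o2) ^+ 2.
  by rewrite exprMn e2 mul1r -sP; ring.
rewrite sqrtr_sqr ger0_norm // exprMn e2 mul1r sP sqrtr1 !divr1.
by rewrite mulrA -expr2 e2 mul1r.
Qed.

Definition hemisphere (e : R) : set 'rV[R]_3 := sphere2 R `&` [set P | 0 <= e * P 0 o2].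

Lemma closed_hemisphere e : closed (hemisphere e).
Proof.
have c3 k : continuous (fun P : 'rV[R]_3 => P 0 k) by exact: coord_row.
apply: closedI.
  have -> : sphere2 R = (fun P : 'rV[R]_3 => \sum_k P 0 k ^+ 2) @^-1` [set x | x = 1] by [].
  apply: closed_comp => [P _|]; last exact: closed_eq.
  by apply: continuous_sumr => k; exact: continuous_sqrr.
apply: (@closed_comp _ _ (fun P : 'rV[R]_3 => e * P 0 o2) [set x | 0 <= x]) => [P _|];
  last exact: closed_ge.
by apply: cont_mul => //; exact: cst_continuous.
Qed.

(** The equator is the union of two graphs over [[-1, 1]], which meet in [(1, 0, 0)]. *)
Lemma connected_equator : connected (hemisphere 1 `&` hemisphere (-1)).
Proof.
pose arc (e x : R) := vec3 x (e * Num.sqrt (1 - x ^+ 2)) 0.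
have carc e : connected (arc e @` `[-1, 1]).
  apply: connected_continuous_connected; first exact: segment_connected.
  apply: continuous_subspaceT; apply: continuous_vec3.
  - by move=> x; exact: cvg_id.
  - apply: cont_mul; first exact: cst_continuous.
    apply: continuous_sqrtr; apply: cont_sub; first exact: cst_continuous.
    by apply: continuous_sqrr => x; exact: cvg_id.
  - exact: cst_continuous.
have -> : hemisphere 1 `&` hemisphere (-1) = (arc 1 @` `[-1, 1]) `|` (arc (-1) @` `[-1, 1]).
  apply/seteqP; split=> [P [[/sphere2P sP /= p0] [_ /= n0]]|P].
    have P2 : P 0 o2 = 0 by lra.
    rewrite P2 expr0n /= addr0 in sP.
    have Px : -1 <= P 0 o0 <= 1.
      by have := sqr_ge0 (P 0 o1) => h; apply/andP; split; nra.
    have s1 : 1 - P 0 o0 ^+ 2 = P 0 o1 ^+ 2 by rewrite -sP; ring.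
    have [h|h] := leP 0 (P 0 o1); [left|right]; exists (P 0 o0);
      rewrite /= ?in_itv //= [RHS]vec3_eta /arc s1 sqrtr_sqr P2.
      by rewrite ger0_norm // mul1r.
    by rewrite ltr0_norm // mulN1r opprK.
  have key e x : e ^+ 2 = 1 -> -1 <= x <= 1 -> (hemisphere 1 `&` hemisphere (-1)) (arc e x).
    move=> e2 /andP[x1 x2].
    have [E0 E1 E2] := vec3E x (e * Num.sqrt (1 - x ^+ 2)) 0.
    have s : sphere2 R (arc e x).
      apply/sphere2P; rewrite /arc E0 E1 E2 exprMn e2 sqr_sqrtr; first by ring.
      by nra.
    by split; split=> //=; rewrite /arc E2 mulr0.
  by case=> -[x]; rewrite /= in_itv /= => xi <-; apply: key => //; rewrite ?sqrrN expr1n.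
apply: connectedU => //.
have i1 : (`[-1, 1] : set R) 1 by rewrite set_itvE /=; apply/andP; split; lra.
exists (arc 1 1); split; exists 1 => //.
by rewrite /arc expr1n subrr sqrtr0 !mulr0.
Qed.

(** The double cover given by [al] is pulled back to the sphere. Each hemisphere projects into a
    square, over which a section exists, and the two hemispheres meet in the connected equator. Read
    at the vertices, the resulting section is the function [h]. *)
Lemma sphere_H1 n (F : {set {set 'I_n}}) :
  homeomorphic (realization R (Tricomplex F)) (sphere2 R) -> H1_trivial F.
Proof.
move=> [f [g [[cf cg] fS gK fK gfK]]] al coc.
set K := realization R (Tricomplex F) in cf fS gK fK.
pose q (t : 'rV[R]_n) i := t 0 i.
have cq i : continuous (fun t : 'rV[R]_n => q t i) by exact: coord_row.
have chK : chart F q K.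
  move=> t [t0 t1 [s sF ts]]; split.
  - apply: contrapT => no; have : \sum_i t 0 i = 0.
      rewrite big1 // => i _; apply: contrapT => /eqP ti; apply: no; exists i.
      by rewrite /q lt_neqAle eq_sym ti t0.
    by rewrite t1 => /eqP; rewrite oner_eq0.
  - exists s => // i; apply: contraTT => /ts; rewrite /q => ->; by rewrite ltxx.
  move=> i ti; have H := cq i t _ (lt_nbhsr ti).
  by apply: (@filterS _ (nbhs t)) H => y.
have chS : chart F (fun P => q (g P)) (sphere2 R) by exact: chart_pullback cg gK _ chK.
have hemi e : e ^+ 2 = 1 -> has_section al (fun P => q (g P)) (hemisphere e).
  move=> e2; have cl : {within setT, continuous (lift_hemisphere e)}.
    exact/continuous_subspaceT/continuous_lift_hemisphere.
  (* [rect_section] asks for a chart on the whole plane, which is why the lift is defined beyond the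
     unit disc. *)
  have ch : chart F (fun p => q (g (lift_hemisphere e p))) setT.
    by apply: chart_pullback cl _ _ chS => // p _; exact: lift_hemisphere_sphere.
  have sec : has_section al (fun p => q (g (lift_hemisphere e p))) (rect (-1) 1 (-1) 1).
    by apply: (rect_section coc ch); lra.
  apply: (section_pullback (phi := fun P : 'rV[R]_3 => (P 0 o0, P 0 o1))) sec.
  - apply: continuous_subspaceT => P.
    exact: (cvg_pair (@coord_row R 3 o0 P) (@coord_row R 3 o1 P)).
  - move=> P [/sphere2P sP _]; have h0 := sqr_ge0 (P 0 o0).
    have h1 := sqr_ge0 (P 0 o1); have h2 := sqr_ge0 (P 0 o2).
    by split=> /=; apply/andP; split; nra.
  - by move=> P [sP eP]; rewrite lift_hemisphereK.
have SE : hemisphere 1 `|` hemisphere (-1) = sphere2 R.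
  apply/seteqP; split=> [P [] []|P sP] //.
  by have [h|h] := leP 0 (P 0 o2); [left|right]; split=> //=; lra.
have secS : has_section al (fun P => q (g P)) (sphere2 R).
  rewrite -SE; apply: (glue_sections (F := F)).
  - exact: closed_hemisphere.
  - exact: closed_hemisphere.
  - exact: connected_equator.
  - by rewrite SE.
  - by apply: hemi; rewrite expr1n.
  - by apply: hemi; rewrite sqrrN expr1n.
have secK : has_section al q K.
  apply: (section_pullback (phi := f)) cf fS _ secS => t Kt.
  by rewrite fK.
pose vx (i : 'I_n) : 'rV[R]_n := delta_mx 0 i.
have [s secs] := secK.
exists (fun i => s (vx i) i) => x y z t.
have [xy yz xz] := tri_neq t.
(* Along the edge, the value of the section at [x] is constant while [x] has positive weight, and
   likewise for [y]. Each is followed from its own vertex to the midpoint, where both are meaningful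
   and differ by [al x y]. *)
pose ga (u : R) : 'rV[R]_n := (1 - u) *: vx x + u *: vx y.
have gax u : ga u 0 x = 1 - u.
  by rewrite !mxE !eqxx (negbTE xy) andbF /=; lra.
have gay u : ga u 0 y = u.
  by rewrite !mxE !eqxx (eq_sym y) (negbTE xy) andbF /=; lra.
have gao u i : i != x -> i != y -> ga u 0 i = 0.
  by move=> ix iy; rewrite !mxE (negbTE ix) (negbTE iy) andbF /=; lra.
have ga0 : ga 0 = vx x by rewrite /ga subr0 scale1r scale0r addr0.
have ga1 : ga 1 = vx y by rewrite /ga subrr scale1r scale0r add0r.
have cga : continuous ga.
  apply: continuous_row => j.
  rewrite (_ : (fun _ => _) = fun u : R => (1 - u) * vx x 0 j + u * vx y 0 j); last first.
    by apply/funext => u; rewrite !mxE.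
  have cid : continuous (fun u : R => u) by move=> u; exact: cvg_id.
  apply: cont_add; apply: cont_mul => //; try exact: cst_continuous.
  by apply: cont_sub => //; exact: cst_continuous.
have gaK u : 0 <= u <= 1 -> K (ga u).
  move=> /andP[u0 u1]; apply/realizationP; split=> [i||].
  - have [->|ix] := eqVneq i x; first by rewrite gax; lra.
    have [->|iy] := eqVneq i y; first by rewrite gay.
    by rewrite gao.
  - rewrite (bigD1 x) //= (bigD1 y) ?(eq_sym y) //= gax gay big1 ?addr0; first by lra.
    by move=> i /andP[ix iy]; exact: gao.
  exists [set x; y; z]%SET; first exact: tri_face t.
  by move=> i; rewrite !inE !negb_or => /andP[/andP[ix iy] _]; exact: gao.
have [s1 s2] := secs.
have const i a b : 0 <= a -> b <= 1 -> (forall u, a <= u <= b -> 0 < ga u 0 i) ->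
    forall u u', a <= u <= b -> a <= u' <= b -> s (ga u) i = s (ga u') i.
  move=> a0 b1 pos u u' hu hu'.
  apply: (connected_locally_constant (d := fun u => s (ga u) i) (@segment_connected R a b)).
  - move=> v; rewrite /= in_itv /= => hv.
    have Kv : K (ga v) by apply: gaK; move: hv => /andP[]; lra.
    have H := cga v _ (s2 _ Kv i (pos _ hv)); apply: (@filterS _ (nbhs v)) H => v' H.
    rewrite /= in_itv /= => hv'; apply: H; apply: gaK; move: hv' => /andP[]; lra.
  - by rewrite /= in_itv.
  - by rewrite /= in_itv.
rewrite -ga0 -ga1.
rewrite (@const x 0 2^-1 _ _ _ 0 2^-1); [|lra|lra| |lra|lra]; last first.
  by move=> u hu; rewrite gax; lra.
rewrite (@const y 2^-1 1 _ _ _ 1 2^-1); [|lra|lra| |lra|lra]; last first.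
  by move=> u hu; rewrite gay; lra.
have h12 : 0 <= (2^-1 : R) <= 1 by apply/andP; split; lra.
rewrite (s1 _ (gaK _ h12) x y) //; first by rewrite /q gax; lra.
by rewrite /q gay; lra.
Qed.

End Sphere.

(** * The exceptional triangulations of the sphere *)

Lemma isomorphic_homeomorphic (R : realType) (G H : tricomplex) :
  isomorphic G H -> homeomorphic (realization R G) (realization R H).
Proof.
case: G H => [n F] [k F'] [h hb /= <-].
exact: homeomorphic_relabel (bij_inj hb).
Qed.

Theorem theorem4p5 (R : realType) (M : nat)
    (hM : flip_threshold R (sphere2 R) M) (G : tricomplex) :
  exceptional R (sphere2 R) M G <-> isomorphic G octahedral_sphere.
Proof.
pose P n (F : {set {set 'I_n}}) := homeomorphic (realization R (Tricomplex F)) (sphere2 R).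
have P_relabel : relabel_invariant P.
  move=> m n h F h_inj; have E := homeomorphic_relabel R F h_inj.
  by split; apply: homeomorphic_trans; [exact: homeomorphic_sym E | exact: E].
have P_subdiv n : subdiv_invariant (@P n).
  move=> F a b m _ mF ab am bm; have E := homeomorphic_subdiv R mF ab am bm.
  by split; apply: homeomorphic_trans; [exact: homeomorphic_sym E | exact: E].
have PE H : P _ (faces H) = homeomorphic (realization R H) (sphere2 R) by case: H.
split=> [[[sG bG hG] noH]|iG].
  apply: contrapT => nG; apply: noH.
  rewrite -PE in hG.
  have [|nsp] := pselect (splittable (faces G)); last first.
    by case: nG; apply: octahedron_of_unsplittable => //; exact: sphere_H1 hG.
  move=> spG.
  have [H [[sH bH hH] [nH cH]]] := unbounded_splittings P_relabel P_subdiv M sG bG spG hG.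
  by exists H; split=> //; split=> //; rewrite -PE.
have sO := oct_triangulation.
have tG : balanced_triangulation_of R (sphere2 R) G.
  split.
  - exact: isomorphic_triangulation iG sO.
  - exact: isomorphic_balanced iG sO oct_balanced.
  - exact: homeomorphic_trans (isomorphic_homeomorphic R iG) (octahedron_sphere R).
split=> // -[H [tH MH GH]].
(* Only renamings lead away from the octahedron, so [H] has 6 vertices and [M <= 6]. The threshold
   then connects [H] with a triangulation [K] on 8 vertices. *)
have iH := P_connected_oct GH iG.
have nv_iso K : isomorphic K octahedral_sphere -> nv K = 6.
  by case=> f fb _; rewrite -(card_ord (nv K)) (bij_eq_card fb) card_ord.
have [sG bG hG] := tG; rewrite -PE in hG.
have [K [sK bK hK nK]] := double_subdivision P_relabel P_subdiv sG bG hG.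
have tK : balanced_triangulation_of R (sphere2 R) K by split=> //; rewrite -PE.
have MK : (M <= nv K)%N by rewrite nK nv_iso // (leq_trans MH) // nv_iso.
have := nv_iso _ (P_connected_oct (hM _ _ tH tK MH MK) iH).
by rewrite nK nv_iso.
Qed.
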